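(* Let $f : X\to S$ be a morphism of locally Noetherian schemes such that for any $x\in X$ the tangent spaces satisfy $\dim T_x \leq \dim T_{f(x)}$. Then any coherent $\mathcal{O}_X$-module that is flat over $S$ is also flat over $X$.
   Context: For a point $x$ of a locally Noetherian scheme $X$, $T_x$ denotes the Zariski tangent space of $X$ at $x$, a vector space over the residue field $\kappa(x)$; similarly $T_{f(x)}$ is the Zariski tangent space of $S$ at $f(x)$, a vector space over $\kappa(f(x))$. Dimensions are taken over these respective fields, so $\dim T_x$ is the embedding dimension (minimal number of generators of the maximal ideal) of $\mathcal{O}_{X,x}$ and $\dim T_{f(x)}$ is that of $\mathcal{O}_{S,f(x)}$. *)

(* Defs.v *)
From HB Require Import structures.
From mathcomp Require Import all_boot all_order all_algebra.
From mathcomp Require Import boolp classical_sets topology_structure.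
From mathcomp Require Import ring.

Set Implicit Arguments.
Unset Strict Implicit.
Unset Printing Implicit Defensive.

Import GRing.Theory.

Local Open Scope classical_set_scope.
Local Open Scope ring_scope.

(* Rings may be zero ([comPzRingType]): sections over the empty open set form
   the zero ring. *)

Section Ideals.
Variable R : comPzRingType.

Definition is_ideal (I : set R) : Prop :=
  [/\ I 0, (forall a b, I a -> I b -> I (a + b)) & forall a b, I b -> I (a * b)].

Definition is_prime (P : set R) : Prop :=
  [/\ is_ideal P, ~ P 1 & forall a b, P (a * b) -> P a \/ P b].

Definition runit (a : R) : Prop := exists b, a * b = 1.

Definition nonunits : set R := [set a | ~ runit a].

(* The zero ring is excluded, as 0 is then a unit; the maximal ideal is
   [nonunits]. *)
Definition is_local : Prop := is_ideal nonunits.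

Definition is_noetherian : Prop :=
  forall I : set R, is_ideal I ->
  exists (n : nat) (g : 'I_n -> R),
    I = [set a | exists c : 'I_n -> R, a = \sum_(i < n) c i * g i].

End Ideals.

Lemma sig_inj T (P : T -> Prop) (x y : {t | P t}) :
  proj1_sig x = proj1_sig y -> x = y.
Proof.
case: x y => [x Px] [y Py] /= exy; case: y / exy in Py *.
by rewrite (Prop_irrelevance Px Py).
Qed.

Section Quotient.
Variables (T : Type) (e : T -> T -> Prop).

Definition quot := {A : set T | exists t, A = e t}.

HB.instance Definition _ := gen_eqMixin quot.
HB.instance Definition _ := gen_choiceMixin quot.

Definition cls (t : T) : quot := exist _ (e t) (ex_intro _ t erefl).

Definition rep (q : quot) : T := proj1_sig (cid (proj2_sig q)).

Lemma repK q : cls (rep q) = q.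
Proof.
by rewrite /rep; case: (cid _) => t /= tq; apply: sig_inj; rewrite /= -tq.
Qed.

Lemma quotP (P : quot -> Prop) : (forall t, P (cls t)) -> forall q, P q.
Proof. by move=> Pc q; rewrite -(repK q). Qed.

Hypothesis e_refl : forall t, e t t.
Hypothesis e_sym : forall t u, e t u -> e u t.
Hypothesis e_trans : forall t u v, e t u -> e u v -> e t v.

Lemma clsP t u : cls t = cls u <-> e t u.
Proof.
split=> [[]|tu]; first by move=> ->; exact: e_refl.
apply: sig_inj; apply/funext => v; apply/propext.
by split; [apply: e_trans (e_sym tu)|apply: e_trans tu].
Qed.

Lemma rep_cls t : e (rep (cls t)) t.
Proof. by apply/clsP; rewrite repK. Qed.

End Quotient.

(* Axioms of an abelian group, resp. of a commutative ring, up to [zeqv]. *)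
Record zmodSetoid := ZmodSetoid {
  zcar :> Type;
  zeqv : zcar -> zcar -> Prop;
  zeqv_refl : forall a, zeqv a a;
  zeqv_sym : forall a b, zeqv a b -> zeqv b a;
  zeqv_trans : forall a b c, zeqv a b -> zeqv b c -> zeqv a c;
  zzero : zcar;
  zopp : zcar -> zcar;
  zadd : zcar -> zcar -> zcar;
  zopp_eqv : forall a a', zeqv a a' -> zeqv (zopp a) (zopp a');
  zadd_eqv : forall a a' b b',
    zeqv a a' -> zeqv b b' -> zeqv (zadd a b) (zadd a' b');
  zaddA : forall a b c, zeqv (zadd a (zadd b c)) (zadd (zadd a b) c);
  zaddC : forall a b, zeqv (zadd a b) (zadd b a);
  zadd0 : forall a, zeqv (zadd zzero a) a;
  zaddN : forall a, zeqv (zadd (zopp a) a) zzero }.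

Record ringSetoid := RingSetoid {
  rbase :> zmodSetoid;
  rone : rbase;
  rmul : rbase -> rbase -> rbase;
  rmul_eqv : forall a a' b b' : rbase,
    zeqv a a' -> zeqv b b' -> zeqv (rmul a b) (rmul a' b');
  rmulA : forall a b c, zeqv (rmul a (rmul b c)) (rmul (rmul a b) c);
  rmulC : forall a b, zeqv (rmul a b) (rmul b a);
  rmul1 : forall a, zeqv (rmul rone a) a;
  rmulDl : forall a b c,
    zeqv (rmul (zadd a b) c) (zadd (rmul a c) (rmul b c)) }.

Section QuotientGroup.
Variable Z : zmodSetoid.
Local Notation Q := (quot (@zeqv Z)).

Lemma qclsP (a b : Z) : cls (@zeqv Z) a = cls (@zeqv Z) b <-> zeqv a b.
Proof. apply: clsP; [exact: zeqv_refl|exact: zeqv_sym|exact: zeqv_trans]. Qed.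

Lemma qrep (a : Z) : zeqv (rep (cls (@zeqv Z) a)) a.
Proof. apply: rep_cls; [exact: zeqv_refl|exact: zeqv_sym|exact: zeqv_trans]. Qed.

Let qadd (a b : Q) : Q := cls _ (zadd (rep a) (rep b)).
Let qopp (a : Q) : Q := cls _ (zopp (rep a)).

Let qaddE a b : qadd (cls _ a) (cls _ b) = cls _ (zadd a b).
Proof. by apply/qclsP; apply: zadd_eqv; exact: qrep. Qed.

Let qoppE a : qopp (cls _ a) = cls _ (zopp a).
Proof. by apply/qclsP; apply: zopp_eqv; exact: qrep. Qed.

Let qaddA : associative qadd.
Proof.
elim/quotP=> a; elim/quotP=> b; elim/quotP=> c.
by rewrite !qaddE; apply/qclsP; exact: zaddA.
Qed.

Let qaddC : commutative qadd.
Proof.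
by elim/quotP=> a; elim/quotP=> b; rewrite !qaddE; apply/qclsP; exact: zaddC.
Qed.

Let qadd0 : left_id (cls _ (zzero Z)) qadd.
Proof. by elim/quotP=> a; rewrite qaddE; apply/qclsP; exact: zadd0. Qed.

Let qaddN : left_inverse (cls _ (zzero Z)) qopp qadd.
Proof.
by elim/quotP=> a; rewrite qoppE qaddE; apply/qclsP; exact: zaddN.
Qed.

Definition quot_zmod : zmodType :=
  HB.pack Q (GRing.isZmodule.Build Q qaddA qaddC qadd0 qaddN).

Definition zclass (a : Z) : quot_zmod := cls _ a.

Lemma zclassP (a b : Z) : zclass a = zclass b <-> zeqv a b.
Proof. exact: qclsP. Qed.

Lemma zclassD (a b : Z) : zclass (zadd a b) = zclass a + zclass b.
Proof. by rewrite -[RHS]/(qadd _ _) qaddE. Qed.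

Lemma zclassN (a : Z) : zclass (zopp a) = - zclass a.
Proof. by rewrite -[RHS]/(qopp _) qoppE. Qed.

Lemma zclass0 : zclass (zzero Z) = 0. Proof. by []. Qed.

Lemma zclassW (P : quot_zmod -> Prop) : (forall a, P (zclass a)) -> forall q, P q.
Proof. exact: quotP. Qed.

End QuotientGroup.

Section QuotientRing.
Variable Z : ringSetoid.
Local Notation Q := (quot_zmod Z).

Let qmul (a b : Q) : Q := zclass (rmul (rep a) (rep b)).

Let qmulE (a b : Z) : qmul (zclass a) (zclass b) = zclass (rmul a b).
Proof. by apply/zclassP; apply: rmul_eqv; exact: qrep. Qed.

Let qmulA : associative qmul.
Proof.
elim/zclassW=> a; elim/zclassW=> b; elim/zclassW=> c.
by rewrite !qmulE; apply/zclassP; exact: rmulA.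
Qed.

Let qmulC : commutative qmul.
Proof.
elim/zclassW=> a; elim/zclassW=> b.
by rewrite !qmulE; apply/zclassP; exact: rmulC.
Qed.

Let qmul1 : left_id (zclass (rone Z)) qmul.
Proof. by elim/zclassW=> a; rewrite qmulE; apply/zclassP; exact: rmul1. Qed.

Let qmulDl : left_distributive qmul +%R.
Proof.
elim/zclassW=> a; elim/zclassW=> b; elim/zclassW=> c.
by rewrite -zclassD !qmulE -zclassD; apply/zclassP; exact: rmulDl.
Qed.

Definition quot_ring : comPzRingType :=
  HB.pack (GRing.Zmodule.sort Q)
    (GRing.Zmodule_isComPzRing.Build Q qmulA qmulC qmul1 qmulDl).

Definition rclass (a : Z) : quot_ring := zclass a.

Lemma rclassP (a b : Z) : rclass a = rclass b <-> zeqv a b.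
Proof. exact: zclassP. Qed.

Lemma rclassD (a b : Z) : rclass (zadd a b) = rclass a + rclass b.
Proof. exact: zclassD. Qed.

Lemma rclassN (a : Z) : rclass (zopp a) = - rclass a.
Proof. exact: zclassN. Qed.

Lemma rclassM (a b : Z) : rclass (rmul a b) = rclass a * rclass b.
Proof. by rewrite -[RHS]/(qmul _ _) qmulE. Qed.

Lemma rclass0 : rclass (zzero Z) = 0. Proof. by []. Qed.

Lemma rclass1 : rclass (rone Z) = 1. Proof. by []. Qed.

Lemma rclassW (P : quot_ring -> Prop) : (forall a, P (rclass a)) -> forall q, P q.
Proof. exact: quotP. Qed.

End QuotientRing.

Section Localization.
Variables (A : comPzRingType) (P : set A) (pP : is_prime P).

Definition denom := {f : A | ~ P f}.

Let denom1 : ~ P 1. Proof. by case: pP. Qed.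

Let denomM (f g : denom) : ~ P (sval f * sval g).
Proof. by case: pP => _ _ pm /pm []; [exact: (svalP f)|exact: (svalP g)]. Qed.

Let dmul (f g : denom) : denom := exist _ (sval f * sval g) (denomM (f:=f) (g:=g)).

Definition frac_eqv (x y : A * denom) : Prop :=
  exists u : denom, sval u * (x.1 * sval y.2) = sval u * (y.1 * sval x.2).

Program Definition frac_zmod : zmodSetoid :=
  @ZmodSetoid (A * denom)%type frac_eqv _ _ _
    (0, exist _ 1 denom1)
    (fun x => (- x.1, x.2))
    (fun x y => (x.1 * sval y.2 + y.1 * sval x.2, dmul x.2 y.2))
    _ _ _ _ _ _.
Next Obligation. by move=> x; exists (exist _ 1 denom1). Qed.
Next Obligation. by move=> x y [u uP]; exists u. Qed.
Next Obligation.
move=> [a f] [b g] [c h] [u /= uP] [v /= vP]; exists (dmul (dmul u v) g) => /=.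
transitivity (sval u * (a * sval g) * (sval v * sval h)); first by ring.
rewrite uP.
transitivity (sval v * (b * sval h) * (sval u * sval f)); first by ring.
by rewrite vP; ring.
Qed.
Next Obligation.
by move=> [a f] [b g] [u /= uP]; exists u => /=; rewrite !mulNr !mulrN uP.
Qed.
Next Obligation.
move=> [a f] [a' f'] [b g] [b' g'] [u /= uP] [v /= vP]; exists (dmul u v) => /=.
transitivity (sval u * (a * sval f') * (sval v * sval g * sval g') +
  sval v * (b * sval g') * (sval u * sval f * sval f')); first by ring.
by rewrite uP vP; ring.
Qed.
Next Obligation.
by move=> [a f] [b g] [c h]; exists (exist _ 1 denom1) => /=; ring.
Qed.
Next Obligation. by move=> [a f] [b g]; exists (exist _ 1 denom1) => /=; ring. Qed.
Next Obligation. by move=> [a f]; exists (exist _ 1 denom1) => /=; ring. Qed.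
Next Obligation. by move=> [a f]; exists (exist _ 1 denom1) => /=; ring. Qed.

Program Definition frac_ring : ringSetoid :=
  @RingSetoid frac_zmod (1, exist _ 1 denom1)
    (fun x y => (x.1 * y.1, dmul x.2 y.2)) _ _ _ _ _.
Next Obligation.
move=> [a f] [a' f'] [b g] [b' g'] [u /= uP] [v /= vP]; exists (dmul u v) => /=.
transitivity (sval u * (a * sval f') * (sval v * (b * sval g'))); first by ring.
by rewrite uP vP; ring.
Qed.
Next Obligation.
by move=> [a f] [b g] [c h]; exists (exist _ 1 denom1) => /=; ring.
Qed.
Next Obligation. by move=> [a f] [b g]; exists (exist _ 1 denom1) => /=; ring. Qed.
Next Obligation. by move=> [a f]; exists (exist _ 1 denom1) => /=; ring. Qed.
Next Obligation.
by move=> [a f] [b g] [c h]; exists (exist _ 1 denom1) => /=; ring.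
Qed.

Definition localization : comPzRingType := quot_ring frac_ring.

Definition frac (a f : A) (hf : ~ P f) : localization :=
  @rclass frac_ring (a, exist _ f hf).

Lemma fracP a f (hf : ~ P f) b g (hg : ~ P g) :
  frac a hf = frac b hg <-> exists2 u, ~ P u & u * (a * g) = u * (b * f).
Proof.
split=> [/rclassP[[u hu] /= e]|[u hu e]]; first by exists u.
by apply/rclassP; exists (exist _ u hu).
Qed.

Lemma frac0 (h1 : ~ P 1) : 0 = frac 0 h1.
Proof.
by rewrite -rclass0; apply/rclassP; exists (exist _ 1 denom1).
Qed.

Lemma frac1 (h1 : ~ P 1) : 1 = frac 1 h1.
Proof.
by rewrite -rclass1; apply/rclassP; exists (exist _ 1 denom1).
Qed.

Lemma fracN a f (hf : ~ P f) : - frac a hf = frac (- a) hf.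
Proof. by rewrite -rclassN. Qed.

Lemma fracD a b f (hf : ~ P f) g (hg : ~ P g) (hfg : ~ P (f * g)) :
  frac a hf + frac b hg = frac (a * g + b * f) hfg.
Proof.
by rewrite -rclassD; apply/rclassP; exists (exist _ 1 denom1).
Qed.

Lemma fracM a b f (hf : ~ P f) g (hg : ~ P g) (hfg : ~ P (f * g)) :
  frac a hf * frac b hg = frac (a * b) hfg.
Proof.
by rewrite -rclassM; apply/rclassP; exists (exist _ 1 denom1).
Qed.

End Localization.

Section Tensor.
Variables (R : comPzRingType) (N M : lmodType R).

(* A list [:: (n_1, m_1); ...; (n_k, m_k)] stands for the element
   n_1 (x) m_1 + ... + n_k (x) m_k of the tensor product of N and M over R;
   [tensor_eq] is equality in the tensor product. *)
Inductive tensor_eq : seq (N * M) -> seq (N * M) -> Prop :=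
| tensor_refl s : tensor_eq s s
| tensor_sym s t : tensor_eq s t -> tensor_eq t s
| tensor_trans s t u : tensor_eq s t -> tensor_eq t u -> tensor_eq s u
| tensor_cat s s' t t' :
    tensor_eq s s' -> tensor_eq t t' -> tensor_eq (s ++ t) (s' ++ t')
| tensor_catC s t : tensor_eq (s ++ t) (t ++ s)
| tensor_0 m : tensor_eq [:: (0, m)] [::]
| tensor_Dl n n' m : tensor_eq [:: (n + n', m)] [:: (n, m); (n', m)]
| tensor_Dr n m m' : tensor_eq [:: (n, m + m')] [:: (n, m); (n, m')]
| tensor_Z a n m : tensor_eq [:: (a *: n, m)] [:: (n, a *: m)].

End Tensor.

Definition flat (R : comPzRingType) (M : lmodType R) : Prop :=
  forall (N N' : lmodType R) (g : {linear N -> N'}), injective g ->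
  forall s t : seq (N * M),
    tensor_eq [seq (g p.1, p.2) | p <- s] [seq (g p.1, p.2) | p <- t] ->
    tensor_eq s t.

Definition restrict_sort (A B : comPzRingType) (phi : {rmorphism A -> B})
  (M : lmodType B) : Type := M.

Section RestrictScalars.
Variables (A B : comPzRingType) (phi : {rmorphism A -> B}) (M : lmodType B).
Local Notation N := (restrict_sort phi M).

HB.instance Definition _ := GRing.Zmodule.on N.

Let rscale (a : A) (m : N) : N := phi a *: (m : M).

Let rscaleA a b m : rscale a (rscale b m) = rscale (a * b) m.
Proof. by rewrite /rscale scalerA rmorphM. Qed.

Let rscale1 : left_id 1 rscale.
Proof. by move=> m; rewrite /rscale rmorph1 scale1r. Qed.

Let rscaleDr : right_distributive rscale +%R.
Proof. by move=> a m n; rewrite /rscale scalerDr. Qed.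

Let rscaleDl m : {morph rscale^~ m : a b / a + b}.
Proof. by move=> a b; rewrite /rscale rmorphD scalerDl. Qed.

HB.instance Definition _ := GRing.Zmodule_isLmodule.Build A N
  rscaleA rscale1 rscaleDr rscaleDl.

Definition restrict_scalars : lmodType A := N.

End RestrictScalars.

Record localRing := LocalRing {
  local_ring :> comPzRingType;
  localP : is_local local_ring }.

Section TangentSpace.
Variable R : localRing.

Definition residue_eqv (a b : R) : Prop := nonunits (a - b).

Program Definition residue_zmod : zmodSetoid :=
  @ZmodSetoid R residue_eqv _ _ _ 0 -%R +%R _ _ _ _ _ _.
Next Obligation. by move=> a; rewrite /residue_eqv subrr; case: (localP R). Qed.
Next Obligation.
move=> a b ab; rewrite /residue_eqv -opprB -mulN1r.
by case: (localP R) => _ _; apply.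
Qed.
Next Obligation.
move=> a b c ab bc; rewrite /residue_eqv -(subrK b a) -addrA.
by case: (localP R) => _ nD _; apply: nD.
Qed.
Next Obligation.
move=> a b ab; rewrite /residue_eqv -opprD -mulN1r.
by case: (localP R) => _ _; apply.
Qed.
Next Obligation.
move=> a a' b b' aa' bb'; rewrite /residue_eqv opprD addrACA.
by case: (localP R) => _ nD _; apply: nD.
Qed.
Next Obligation. by move=> a b c; rewrite /residue_eqv addrA subrr; case: (localP R). Qed.
Next Obligation. by move=> a b; rewrite /residue_eqv (addrC b) subrr; case: (localP R). Qed.
Next Obligation. by move=> a; rewrite /residue_eqv add0r subrr; case: (localP R). Qed.
Next Obligation. by move=> a; rewrite /residue_eqv addNr subrr; case: (localP R). Qed.

Program Definition residue_ring : ringSetoid :=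
  @RingSetoid residue_zmod 1 *%R _ _ _ _ _.
Next Obligation.
move=> a a' b b' aa' bb'; rewrite /= /residue_eqv.
have -> : a * b - a' * b' = b * (a - a') + a' * (b - b') by ring.
by case: (localP R) => _ nD nM; apply: nD; apply: nM.
Qed.
Next Obligation. by move=> a b c; rewrite /= /residue_eqv mulrA subrr; case: (localP R). Qed.
Next Obligation. by move=> a b; rewrite /= /residue_eqv mulrC subrr; case: (localP R). Qed.
Next Obligation. by move=> a; rewrite /= /residue_eqv mul1r subrr; case: (localP R). Qed.
Next Obligation.
move=> a b c; rewrite /= /residue_eqv mulrDl subrr.
by case: (localP R).
Qed.

Definition residue_field : comPzRingType := quot_ring residue_ring.

Definition residue (a : R) : residue_field := @rclass residue_ring a.

Definition max_ideal : Type := {a : R | nonunits a}.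

(* The tangent space is the dual of m/m^2 over k = R/m.  A map m -> k that is
   linear over R vanishes on products of two elements of m, so that linear
   forms on m/m^2 are the same as R-linear maps m -> k. *)
Definition is_tangent (theta : max_ideal -> residue_field) : Prop :=
  forall (a : R) (y z w : max_ideal), sval w = a * sval y + sval z ->
    theta w = residue a * theta y + theta z.

Definition is_tangent_basis (n : nat) (t : 'I_n -> max_ideal -> residue_field) :
    Prop :=
  (forall i, is_tangent (t i)) /\
  forall theta, is_tangent theta ->
    exists! c : 'I_n -> residue_field,
      theta = fun y => \sum_(i < n) c i * t i y.

(* Always attained when R is noetherian, since m/m^2 is then finite-dimensional. *)
Definition tangent_dim : nat :=
  xget 0%N [set n | exists t, @is_tangent_basis n t].

End TangentSpace.

Record opens (X : topologicalType) := Opens {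
  carrier :> set X;
  carrier_open : open carrier }.

Definition opens_cap (X : topologicalType) (U V : opens X) : opens X :=
  Opens (openI (carrier_open U) (carrier_open V)).

Lemma capl (X : topologicalType) (U V : opens X) : opens_cap U V `<=` U.
Proof. by move=> x []. Qed.

Lemma capr (X : topologicalType) (U V : opens X) : opens_cap U V `<=` V.
Proof. by move=> x []. Qed.

Section SheafAxiom.
Variables (X : topologicalType) (P : opens X -> Type).
Variable r : forall U V : opens X, V `<=` U -> P U -> P V.

Definition is_sheaf : Prop :=
  forall (U : opens X) (I : Type) (V : I -> opens X) (VU : forall i, V i `<=` U),
  U `<=` \bigcup_i V i ->
  forall s : forall i, P (V i),
  (forall i j, r (@capl _ (V i) (V j)) (s i) = r (@capr _ (V i) (V j)) (s j)) ->
  exists! t : P U, forall i, r (VU i) t = s i.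

End SheafAxiom.

(* Used for the common part of the stalks of a
   sheaf of rings and of a sheaf of modules. *)
Record presheaf (X : topologicalType) := Presheaf {
  psec : opens X -> zmodType;
  pres : forall U V : opens X, V `<=` U -> psec U -> psec V;
  presB : forall (U V : opens X) (h : V `<=` U) (s t : psec U),
    pres h (s - t) = pres h s - pres h t;
  pres_id : forall (U : opens X) (h : U `<=` U) (s : psec U), pres h s = s;
  pres_comp : forall (U V W : opens X) (h : V `<=` U) (k : W `<=` V)
    (l : W `<=` U) (s : psec U), pres k (pres h s) = pres l s }.

Record ringedSpace := RingedSpace {
  space :> topologicalType;
  sec : opens space -> comPzRingType;
  res : forall U V : opens space, V `<=` U -> {rmorphism sec U -> sec V};
  res_id : forall (U : opens space) (h : U `<=` U) (s : sec U), res h s = s;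
  res_comp : forall (U V W : opens space) (h : V `<=` U) (k : W `<=` V)
    (l : W `<=` U) (s : sec U), res k (res h s) = res l s;
  res_sheaf : is_sheaf (P := sec) (fun U V h s => res h s) }.

Record moduleSheaf (X : ringedSpace) := ModuleSheaf {
  msec : forall U : opens X, lmodType (sec U);
  mres : forall U V : opens X, V `<=` U -> msec U -> msec V;
  mresB : forall (U V : opens X) (h : V `<=` U) (s t : msec U),
    mres h (s - t) = mres h s - mres h t;
  mresZ : forall (U V : opens X) (h : V `<=` U) (a : sec U) (s : msec U),
    mres h (a *: s) = res h a *: mres h s;
  mres_id : forall (U : opens X) (h : U `<=` U) (s : msec U), mres h s = s;
  mres_comp : forall (U V W : opens X) (h : V `<=` U) (k : W `<=` V)
    (l : W `<=` U) (s : msec U), mres k (mres h s) = mres l s;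
  mres_sheaf : is_sheaf (P := fun U => msec U) mres }.

Record germ (X : topologicalType) (P : opens X -> Type) (x : X) := Germ {
  gdom : opens X;
  gmem : carrier gdom x;
  gsec : P gdom }.

Section Stalk.
Variables (X : topologicalType) (F : presheaf X) (x : X).

Lemma pres0 (U V : opens X) (h : V `<=` U) : pres (p := F) h 0 = 0.
Proof. by rewrite -(subrr 0) presB subrr. Qed.

Lemma presN (U V : opens X) (h : V `<=` U) (s : psec F U) :
  pres h (- s) = - pres h s.
Proof. by rewrite -sub0r presB pres0 sub0r. Qed.

Lemma presD (U V : opens X) (h : V `<=` U) (s t : psec F U) :
  pres h (s + t) = pres h s + pres h t.
Proof. by rewrite -{1}(opprK t) presB presN opprK. Qed.

Lemma pres_trans (U V W : opens X) (h : V `<=` U) (k : W `<=` V) (s : psec F U) :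
  pres k (pres h s) = pres (subset_trans k h) s.
Proof. exact: pres_comp. Qed.

Lemma pres_irr (U V : opens X) (h h' : V `<=` U) (s : psec F U) :
  pres h s = pres h' s.
Proof. by rewrite (Prop_irrelevance h h'). Qed.

Definition germ_eqv (s t : germ (psec F) x) : Prop :=
  exists (W : opens X) (hs : W `<=` gdom s) (ht : W `<=` gdom t),
    carrier W x /\ pres hs (gsec s) = pres ht (gsec t).

Lemma openT_opens : opens X. Proof. exact: Opens openT. Defined.

Program Definition germ_zmod : zmodSetoid :=
  @ZmodSetoid (germ (psec F) x) germ_eqv _ _ _
    (@Germ _ _ _ openT_opens I 0)
    (fun s => Germ (gmem s) (- gsec s))
    (fun s t => @Germ _ _ _ (opens_cap (gdom s) (gdom t)) (conj (gmem s) (gmem t))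
       (pres (@capl _ _ _) (gsec s) + pres (@capr _ _ _) (gsec t)))
    _ _ _ _ _ _.
Next Obligation. by move=> s; exists (gdom s), (@subset_refl _ _), (@subset_refl _ _); split=> //; exact: gmem. Qed.
Next Obligation. by move=> s t [W [hs [ht [Wx e]]]]; exists W, ht, hs. Qed.
Next Obligation.
move=> s t u [W [hs [ht [Wx e]]]] [W' [ht' [hu [Wx' e']]]].
exists (opens_cap W W'), (subset_trans (@capl _ _ _) hs), (subset_trans (@capr _ _ _) hu).
split; first by [].
rewrite -(pres_comp hs (@capl _ W W')) -(pres_comp hu (@capr _ W W')) e -e'.
by rewrite !(pres_comp _ _ (subset_trans (@capl _ W W') ht)).
Qed.
Next Obligation.
by move=> s t [W [hs [ht [Wx e]]]]; exists W, hs, ht; split=> //=; rewrite !presN e.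
Qed.
Next Obligation.
move=> s s' t t' [W [hs [hs' [Wx e]]]] [V [ht [ht' [Vx e']]]].
have h : opens_cap W V `<=` opens_cap (gdom s) (gdom t).
  by move=> y [? ?]; split; [exact: (hs y)|exact: (ht y)].
have h' : opens_cap W V `<=` opens_cap (gdom s') (gdom t').
  by move=> y [? ?]; split; [exact: (hs' y)|exact: (ht' y)].
exists (opens_cap W V), h, h'; split=> //=; rewrite !presD; congr (_ + _).
  rewrite !pres_trans (pres_irr _ (subset_trans (@capl _ W V) hs)).
  by rewrite -(pres_comp hs (@capl _ W V)) e; apply: pres_comp.
rewrite !pres_trans (pres_irr _ (subset_trans (@capr _ W V) ht)).
by rewrite -(pres_comp ht (@capr _ W V)) e'; apply: pres_comp.
Qed.
Next Obligation.
move=> s t u; pose A := opens_cap (gdom s) (opens_cap (gdom t) (gdom u)).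
pose B := opens_cap (opens_cap (gdom s) (gdom t)) (gdom u).
have hA : B `<=` A by move=> y [[? ?] ?].
have h1 : B `<=` gdom s by move=> y [[? ?] ?].
have h2 : B `<=` gdom t by move=> y [[? ?] ?].
have h3 : B `<=` gdom u by move=> y [[? ?] ?].
exists B, hA, (@subset_refl _ _); split; first by do ?split; exact: gmem.
rewrite /= !presD !pres_trans addrA.
by congr (_ + _ + _); exact: pres_irr.
Qed.
Next Obligation.
move=> s t; exists (opens_cap (gdom s) (gdom t)), (@subset_refl _ _).
have h : opens_cap (gdom s) (gdom t) `<=` opens_cap (gdom t) (gdom s) by move=> y [].
exists h; split; first by split; exact: gmem.
rewrite /= !presD !pres_trans addrC.
by congr (_ + _); exact: pres_irr.
Qed.
Next Obligation.
move=> s; have h : gdom s `<=` opens_cap openT_opens (gdom s) by [].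
exists (gdom s), h, (@subset_refl _ _); split; first exact: gmem.
by rewrite /= presD !pres_trans pres0 add0r; exact: pres_irr.
Qed.
Next Obligation.
move=> s; have h : gdom s `<=` opens_cap (gdom s) (gdom s) by [].
exists (gdom s), h, (fun _ _ => I); split; first exact: gmem.
rewrite /= presD !pres_trans presN pres0 addrC; apply/eqP; rewrite subr_eq0.
by apply/eqP; exact: pres_irr.
Qed.

Definition stalk_zmod : zmodType := quot_zmod germ_zmod.

End Stalk.

Section RingStalk.
Variables (X : ringedSpace) (x : X).

Definition ring_presheaf : presheaf X :=
  @Presheaf X (@sec X) (fun U V h s => res h s)
    (fun U V h s t => rmorphB (res h) s t) (@res_id X) (@res_comp X).

Lemma res_trans (U V W : opens X) (h : V `<=` U) (k : W `<=` V) (s : sec U) :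
  res k (res h s) = res (subset_trans k h) s.
Proof. exact: res_comp. Qed.

Lemma res_irr (U V : opens X) (h h' : V `<=` U) (s : sec U) : res h s = res h' s.
Proof. by rewrite (Prop_irrelevance h h'). Qed.

Program Definition germ_ring : ringSetoid :=
  @RingSetoid (germ_zmod ring_presheaf x)
    (@Germ _ _ _ (openT_opens X) I 1)
    (fun s t => @Germ _ _ _ (opens_cap (gdom s) (gdom t)) (conj (gmem s) (gmem t))
       (res (@capl _ _ _) (gsec s) * res (@capr _ _ _) (gsec t)))
    _ _ _ _ _.
Next Obligation.
move=> s s' t t' [W [hs [hs' [Wx e]]]] [V [ht [ht' [Vx e']]]].
move: e e' => /= e e'.
have h : opens_cap W V `<=` opens_cap (gdom s) (gdom t).
  by move=> y [? ?]; split; [exact: (hs y)|exact: (ht y)].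
have h' : opens_cap W V `<=` opens_cap (gdom s') (gdom t').
  by move=> y [? ?]; split; [exact: (hs' y)|exact: (ht' y)].
exists (opens_cap W V), h, h'; split=> //=; rewrite !rmorphM; congr (_ * _).
  rewrite !res_trans (res_irr _ (subset_trans (@capl _ W V) hs)).
  by rewrite -(res_comp hs (@capl _ W V)) e; apply: res_comp.
rewrite !res_trans (res_irr _ (subset_trans (@capr _ W V) ht)).
by rewrite -(res_comp ht (@capr _ W V)) e'; apply: res_comp.
Qed.
Next Obligation.
move=> s t u; pose A := opens_cap (gdom s) (opens_cap (gdom t) (gdom u)).
pose B := opens_cap (opens_cap (gdom s) (gdom t)) (gdom u).
have hA : B `<=` A by move=> y [[? ?] ?].
have h1 : B `<=` gdom s by move=> y [[? ?] ?].
have h2 : B `<=` gdom t by move=> y [[? ?] ?].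
have h3 : B `<=` gdom u by move=> y [[? ?] ?].
exists B, hA, (@subset_refl _ _); split; first by do ?split; exact: gmem.
rewrite /= !rmorphM !res_trans mulrA.
by congr (_ * _ * _); exact: res_irr.
Qed.
Next Obligation.
move=> s t; exists (opens_cap (gdom s) (gdom t)), (@subset_refl _ _).
have h : opens_cap (gdom s) (gdom t) `<=` opens_cap (gdom t) (gdom s) by move=> y [].
exists h; split; first by split; exact: gmem.
rewrite /= !rmorphM !res_trans mulrC.
by congr (_ * _); exact: res_irr.
Qed.
Next Obligation.
move=> s; have h : gdom s `<=` opens_cap (openT_opens X) (gdom s) by [].
exists (gdom s), h, (@subset_refl _ _); split; first exact: gmem.
by rewrite /= rmorphM !rmorph1 mul1r res_trans; exact: res_irr.
Qed.
Next Obligation.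
move=> s t u; pose A := opens_cap (opens_cap (gdom s) (gdom t)) (gdom u).
pose B := opens_cap (opens_cap (gdom s) (gdom u)) (opens_cap (gdom t) (gdom u)).
have hA : A `<=` B by move=> y [[? ?] ?].
have h1 : A `<=` gdom s by move=> y [[? ?] ?].
have h2 : A `<=` gdom t by move=> y [[? ?] ?].
have h3 : A `<=` gdom u by move=> y [[? ?] ?].
exists A, (@subset_refl _ _), hA; split; first by do ?split; exact: gmem.
rewrite /= !(rmorphM, rmorphD).
rewrite !res_trans mulrDl.
by congr (_ * _ + _ * _); exact: res_irr.
Qed.

Definition stalk : comPzRingType := quot_ring germ_ring.

Definition germ_at (U : opens X) (Ux : carrier U x) (s : sec U) : stalk :=
  @rclass germ_ring (@Germ _ (@sec X) _ U Ux s).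

End RingStalk.

Section ModuleStalk.
Variables (X : ringedSpace) (F : moduleSheaf X) (x : X).

Definition module_presheaf : presheaf X :=
  @Presheaf X (@msec X F) (@mres X F) (@mresB X F) (@mres_id X F) (@mres_comp X F).

Local Notation O := (germ_ring x).
Local Notation M := (germ_zmod module_presheaf x).

Definition germ_scale (a : O) (s : M) : M :=
  @Germ _ _ _ (opens_cap (gdom a) (gdom s)) (conj (gmem a) (gmem s))
    (res (@capl _ _ _) (gsec a) *: mres (@capr _ _ _) (gsec s)).

Let mresD (U V : opens X) (h : V `<=` U) (s t : msec F U) :
  mres h (s + t) = mres h s + mres h t.
Proof. exact: (presD (F := module_presheaf)). Qed.

Let mres_trans (U V W : opens X) (h : V `<=` U) (k : W `<=` V) (s : msec F U) :
  mres k (mres h s) = mres (subset_trans k h) s.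
Proof. exact: mres_comp. Qed.

Let mres_irr (U V : opens X) (h h' : V `<=` U) (s : msec F U) :
  mres h s = mres h' s.
Proof. by rewrite (Prop_irrelevance h h'). Qed.

Lemma germ_scale_eqv (a a' : O) (s s' : M) :
  zeqv a a' -> zeqv s s' -> zeqv (germ_scale a s) (germ_scale a' s').
Proof.
move=> [W [hs [hs' [Wx e]]]] [V [ht [ht' [Vx e']]]].
move: e e' => /= e e'.
have h : opens_cap W V `<=` opens_cap (gdom a) (gdom s).
  by move=> y [? ?]; split; [exact: (hs y)|exact: (ht y)].
have h' : opens_cap W V `<=` opens_cap (gdom a') (gdom s').
  by move=> y [? ?]; split; [exact: (hs' y)|exact: (ht' y)].
exists (opens_cap W V), h, h'; split=> //=; rewrite !mresZ; congr (_ *: _).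
  rewrite !res_trans (res_irr _ (subset_trans (@capl _ W V) hs)).
  by rewrite -(res_comp hs (@capl _ W V)) e; apply: res_comp.
rewrite !mres_trans (mres_irr _ (subset_trans (@capr _ W V) ht)).
by rewrite -(mres_comp ht (@capr _ W V)) e'; apply: mres_comp.
Qed.

Let mscale (a : stalk x) (s : stalk_zmod module_presheaf x) :
  stalk_zmod module_presheaf x := zclass (germ_scale (rep a) (rep s)).

Let mscaleE (a : O) (s : M) : mscale (rclass a) (zclass s) = zclass (germ_scale a s).
Proof. by apply/zclassP; apply: germ_scale_eqv; exact: qrep. Qed.

Let mscaleA a b s : mscale a (mscale b s) = mscale (a * b) s.
Proof.
elim/rclassW: a => a; elim/rclassW: b => b; elim/zclassW: s => s.
rewrite -rclassM !mscaleE; apply/zclassP.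
pose A := opens_cap (gdom a) (opens_cap (gdom b) (gdom s)).
pose B := opens_cap (opens_cap (gdom a) (gdom b)) (gdom s).
have hA : B `<=` A by move=> y [[? ?] ?].
exists B, hA, (@subset_refl _ _); split; first by do ?split; exact: gmem.
rewrite /= !mresZ !rmorphM !res_trans !mres_trans scalerA.
by congr (_ * _ *: _); first [exact: res_irr|exact: mres_irr].
Qed.

Let mscale1 : left_id 1 mscale.
Proof.
elim/zclassW=> s; rewrite -rclass1 mscaleE; apply/zclassP.
have h : gdom s `<=` opens_cap (openT_opens X) (gdom s) by [].
exists (gdom s), h, (@subset_refl _ _); split; first exact: gmem.
by rewrite /= mresZ !rmorph1 scale1r mres_trans; exact: mres_irr.
Qed.

Let mscaleDr : right_distributive mscale +%R.
Proof.
elim/rclassW=> a; elim/zclassW=> s; elim/zclassW=> t.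
rewrite -zclassD !mscaleE -zclassD; apply/zclassP.
pose A := opens_cap (gdom a) (opens_cap (gdom s) (gdom t)).
pose B := opens_cap (opens_cap (gdom a) (gdom s)) (opens_cap (gdom a) (gdom t)).
have hA : A `<=` B by move=> y [? [? ?]].
exists A, (@subset_refl _ _), hA; split; first by do ?split; exact: gmem.
rewrite /= !(mresZ, mresD) !res_trans !mres_trans scalerDr.
by congr (_ *: _ + _ *: _); first [exact: res_irr|exact: mres_irr].
Qed.

Let mscaleDl s : {morph mscale^~ s : a b / a + b}.
Proof.
elim/rclassW=> a; elim/rclassW=> b; elim/zclassW: s => s.
rewrite -rclassD !mscaleE -zclassD; apply/zclassP.
pose A := opens_cap (opens_cap (gdom a) (gdom b)) (gdom s).
pose B := opens_cap (opens_cap (gdom a) (gdom s)) (opens_cap (gdom b) (gdom s)).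
have hA : A `<=` B by move=> y [[? ?] ?].
exists A, (@subset_refl _ _), hA; split; first by do ?split; exact: gmem.
rewrite /= !(mresZ, mresD, rmorphD) !res_trans !mres_trans scalerDl.
by congr (_ *: _ + _ *: _); first [exact: res_irr|exact: mres_irr].
Qed.

Definition mstalk : lmodType (stalk x) :=
  HB.pack (GRing.Zmodule.sort (stalk_zmod module_presheaf x))
    (GRing.Zmodule_isLmodule.Build (stalk x) (stalk_zmod module_presheaf x)
       mscaleA mscale1 mscaleDr mscaleDl).

Definition mgerm_at (U : opens X) (Ux : carrier U x) (s : msec F U) : mstalk :=
  zclass (@Germ _ (psec module_presheaf) _ U Ux s : M).

Lemma mstalk_scaleE (a : O) (s : M) :
  (rclass a : stalk x) *: (zclass s : mstalk) = zclass (germ_scale a s).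
Proof. exact: mscaleE. Qed.

End ModuleStalk.

Definition opens_preim (X Y : topologicalType) (f : X -> Y) (cf : continuous f)
    (V : opens Y) : opens X :=
  Opens ((continuousP f).1 cf V (carrier_open V)).

Record ringedHom (X Y : ringedSpace) := RingedHom {
  hmap :> X -> Y;
  hmap_continuous : continuous hmap;
  comap : forall V : opens Y, {rmorphism sec V -> sec (opens_preim hmap_continuous V)};
  comap_res : forall (V W : opens Y) (h : W `<=` V)
    (k : opens_preim hmap_continuous W `<=` opens_preim hmap_continuous V)
    (s : sec V), res k (comap V s) = comap W (res h s) }.

Arguments hmap_continuous {X Y} r : rename.

Section StalkMap.
Variables (X Y : ringedSpace) (f : ringedHom X Y) (x : X).

Lemma comap_resE (V W : opens Y) (h : W `<=` V) (s : sec V) :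
  comap f W (res h s) =
  res ((fun y => h (f y)) : opens_preim (hmap_continuous f) W `<=`
        opens_preim (hmap_continuous f) V) (comap f V s).
Proof. by rewrite comap_res. Qed.

Definition germ_map (s : germ_ring (f x)) : germ_ring x :=
  @Germ _ (@sec X) x (opens_preim (hmap_continuous f) (gdom s)) (gmem s)
    (comap f (gdom s) (gsec s)).

Lemma germ_map_eqv s t : zeqv s t -> zeqv (germ_map s) (germ_map t).
Proof.
move=> [W [hs [ht [Wx /= e]]]].
exists (opens_preim (hmap_continuous f) W), (fun y => hs (f y)), (fun y => ht (f y)).
by split=> //=; rewrite !comap_res; first exact: (congr1 (comap f W) e).
Qed.

Definition stalk_fun (a : stalk (f x)) : stalk x := rclass (germ_map (rep a)).

Lemma stalk_funE s : stalk_fun (rclass s) = rclass (germ_map s).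
Proof. by apply/rclassP; apply: germ_map_eqv; exact: qrep. Qed.

Let stalk_funB : zmod_morphism stalk_fun.
Proof.
elim/rclassW=> s; elim/rclassW=> t.
rewrite -rclassN -rclassD !stalk_funE -rclassN -rclassD; apply/rclassP.
pose A := opens_preim (hmap_continuous f) (opens_cap (gdom s) (gdom t)).
have h : A `<=` opens_cap (opens_preim (hmap_continuous f) (gdom s))
                          (opens_preim (hmap_continuous f) (gdom t)) by [].
exists A, (@subset_refl _ _), h; split; first by split; exact: gmem.
rewrite /= !(rmorphD, rmorphN) /= !comap_resE !res_trans.
by congr (_ - _); exact: res_irr.
Qed.

Let stalk_funM : monoid_morphism stalk_fun.
Proof.
split.
  rewrite -[1]rclass1 stalk_funE -rclass1; apply/rclassP.
  exists (openT_opens X), (fun _ _ => I), (fun _ _ => I); split=> //.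
  by rewrite /= !rmorph1.
elim/rclassW=> s; elim/rclassW=> t.
rewrite -rclassM !stalk_funE -rclassM; apply/rclassP.
pose A := opens_preim (hmap_continuous f) (opens_cap (gdom s) (gdom t)).
have h : A `<=` opens_cap (opens_preim (hmap_continuous f) (gdom s))
                          (opens_preim (hmap_continuous f) (gdom t)) by [].
exists A, (@subset_refl _ _), h; split; first by split; exact: gmem.
rewrite /= !rmorphM /= !comap_resE !res_trans.
by congr (_ * _); exact: res_irr.
Qed.

Definition stalk_map : {rmorphism stalk (f x) -> stalk x} :=
  HB.pack stalk_fun
    (GRing.isZmodMorphism.Build _ _ stalk_fun stalk_funB)
    (GRing.isMonoidMorphism.Build _ _ stalk_fun stalk_funM).

End StalkMap.

Definition is_local_hom (A B : comPzRingType) (phi : A -> B) : Prop :=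
  forall a, nonunits a -> nonunits (phi a).

(* f induces an isomorphism of X onto an open subspace of Y. *)
Definition open_immersion (X Y : ringedSpace) (f : ringedHom X Y) : Prop :=
  [/\ injective f,
      (forall U : set X, open U -> open (f @` U)) &
      forall V : opens Y, V `<=` range f -> bijective (comap f V)].

Record spec (A : comPzRingType) := Prime {
  prime_set :> set A;
  primeP : is_prime prime_set }.

HB.instance Definition _ (A : comPzRingType) := gen_eqMixin (spec A).
HB.instance Definition _ (A : comPzRingType) := gen_choiceMixin (spec A).

Section ZariskiTopology.
Variable A : comPzRingType.

(* The complement of the set of primes that contain E. *)
Definition zariski_compl (E : set A) : set (spec A) := [set p | ~ (E `<=` p)].

Definition zariski_open (U : set (spec A)) : Prop :=
  exists E : set A, U = zariski_compl E.

Let zariski_openT : zariski_open setT.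
Proof.
exists [set 1]; apply/seteqP; split=> // p _ /= p1.
by case: (primeP p) => _ + _; apply; exact: p1.
Qed.

Let zariski_openI : setI_closed zariski_open.
Proof.
move=> _ _ [E ->] [F ->].
exists [set c | exists a b, [/\ E a, F b & c = a * b]].
apply/seteqP; split=> p /=; case: (primeP p) => [[_ _ idM] _ pM].
  move=> [/existsNP[a /not_implyP[Ea pa]] /existsNP[b /not_implyP[Fb pb]]] EFp.
  by have /pM[] : prime_set p (a * b) by apply: EFp; exists a, b.
move=> pab; split=> h; apply: pab => _ [a [b [Ea Fb ->]]].
  by rewrite mulrC; apply: idM; exact: h.
by apply: idM; exact: h.
Qed.

Let zariski_open_bigU (I : Type) (f : I -> set (spec A)) :
  (forall i, zariski_open (f i)) -> zariski_open (\bigcup_i f i).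
Proof.
move=> fo; have [E fE] := choice fo.
exists (\bigcup_i E i); apply/seteqP; split=> p /=.
  move=> [i _]; rewrite fE => + Ep; apply=> a Ea.
  by apply: Ep; exists i.
move=> /existsNP[a /not_implyP[[i _ Ea] pa]].
by exists i => //; rewrite fE => Ep; apply: pa; exact: Ep.
Qed.

HB.instance Definition _ := isOpenTopological.Build (spec A)
  zariski_openT zariski_openI zariski_open_bigU.

Lemma spec_openE : (open : set (set (spec A))) = zariski_open.
Proof. by []. Qed.

End ZariskiTopology.

Section StructureSheaf.
Variable A : comPzRingType.
Implicit Types U V W : opens (spec A).

Local Notation loc p := (localization (primeP p)).

Definition locally_fraction U (s : forall p, carrier U p -> loc p) : Prop :=
  forall p, carrier U p -> exists (V : opens (spec A)) (VU : V `<=` U),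
    carrier V p /\ exists a f : A, forall q (Vq : carrier V q),
      exists hf : ~ prime_set q f, s q (VU q Vq) = frac (primeP q) a hf.

Definition spec_section U : Type :=
  {s : forall p, carrier U p -> loc p | locally_fraction s}.

Lemma spec_section_eq U (s t : spec_section U) :
  (forall p Up, sval s p Up = sval t p Up) -> s = t.
Proof.
by move=> st; apply: sig_inj; apply/functional_extensionality_dep => p;
  apply/functional_extensionality_dep => Up; exact: st.
Qed.

HB.instance Definition _ U := gen_eqMixin (spec_section U).
HB.instance Definition _ U := gen_choiceMixin (spec_section U).

Let one_notin (q : spec A) : ~ prime_set q 1. Proof. by case: (primeP q). Qed.

Let mul_notin (q : spec A) f g : ~ prime_set q f -> ~ prime_set q g -> ~ prime_set q (f * g).
Proof. by case: (primeP q) => _ _ pM qf qg /pM[]. Qed.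

Let sec_cst U (a : A) : locally_fraction
  (fun p (_ : carrier U p) => frac (primeP p) a (@one_notin p)).
Proof.
move=> p Up; exists U, (@subset_refl _ _); split=> //; exists a, 1 => q Uq.
by exists (@one_notin q).
Qed.

Definition spec_cst U (a : A) : spec_section U := exist _ _ (@sec_cst U a).

Let sec_opp U (s : spec_section U) :
  locally_fraction (fun p (Up : carrier U p) => - sval s p Up).
Proof.
move=> p Up; have [V [VU [Vp [a [f h]]]]] := svalP s p Up.
exists V, VU; split=> //; exists (- a), f => q Vq.
by have [hf ->] := h q Vq; exists hf; rewrite fracN.
Qed.

Let sec_add U (s t : spec_section U) :
  locally_fraction (fun p (Up : carrier U p) => sval s p Up + sval t p Up).
Proof.
move=> p Up; have [V [VU [Vp [a [f h]]]]] := svalP s p Up.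
have [W [WU [Wp [b [g k]]]]] := svalP t p Up.
exists (opens_cap V W), (subset_trans (@capl _ V W) VU); split; first by split.
exists (a * g + b * f), (f * g) => q [Vq Wq].
have [hf es] := h q Vq; have [hg et] := k q Wq; exists (mul_notin hf hg).
rewrite -(fracD _ _ _ hf hg) -es -et.
by congr (_ + _); [congr (sval s q _)|congr (sval t q _)]; exact: Prop_irrelevance.
Qed.

Let sec_mul U (s t : spec_section U) :
  locally_fraction (fun p (Up : carrier U p) => sval s p Up * sval t p Up).
Proof.
move=> p Up; have [V [VU [Vp [a [f h]]]]] := svalP s p Up.
have [W [WU [Wp [b [g k]]]]] := svalP t p Up.
exists (opens_cap V W), (subset_trans (@capl _ V W) VU); split; first by split.
exists (a * b), (f * g) => q [Vq Wq].
have [hf es] := h q Vq; have [hg et] := k q Wq; exists (mul_notin hf hg).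
rewrite -(fracM _ _ _ hf hg) -es -et.
by congr (_ * _); [congr (sval s q _)|congr (sval t q _)]; exact: Prop_irrelevance.
Qed.

Section SectionRing.
Variable U : opens (spec A).
Let S := spec_section U.
Let sadd (s t : S) : S := exist _ _ (sec_add s t).
Let smul (s t : S) : S := exist _ _ (sec_mul s t).
Let sopp (s : S) : S := exist _ _ (sec_opp s).

Let saddA : associative sadd.
Proof. by move=> s t u; apply: spec_section_eq => p Up; rewrite /= addrA. Qed.
Let saddC : commutative sadd.
Proof. by move=> s t; apply: spec_section_eq => p Up; rewrite /= addrC. Qed.
Let sadd0 : left_id (spec_cst U 0) sadd.
Proof. by move=> s; apply: spec_section_eq => p Up; rewrite /= -frac0 add0r. Qed.
Let saddN : left_inverse (spec_cst U 0) sopp sadd.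
Proof. by move=> s; apply: spec_section_eq => p Up; rewrite /= -frac0 addNr. Qed.

HB.instance Definition _ :=
  GRing.isZmodule.Build (spec_section U) saddA saddC sadd0 saddN.

Let smulA : associative smul.
Proof. by move=> s t u; apply: spec_section_eq => p Up; rewrite /= mulrA. Qed.
Let smulC : commutative smul.
Proof. by move=> s t; apply: spec_section_eq => p Up; rewrite /= mulrC. Qed.
Let smul1 : left_id (spec_cst U 1) smul.
Proof. by move=> s; apply: spec_section_eq => p Up; rewrite /= -frac1 mul1r. Qed.
Let smulDl : left_distributive smul +%R.
Proof. by move=> s t u; apply: spec_section_eq => p Up; rewrite /= mulrDl. Qed.

HB.instance Definition _ :=
  GRing.Zmodule_isComPzRing.Build (spec_section U) smulA smulC smul1 smulDl.

End SectionRing.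

Section Restriction.
Variables (U V : opens (spec A)) (VU : V `<=` U).

Let sec_res (s : spec_section U) :
  locally_fraction (fun p (Vp : carrier V p) => sval s p (VU Vp)).
Proof.
move=> p Vp; have [W [WU [Wp [a [f h]]]]] := svalP s p (VU Vp).
exists (opens_cap V W), (@capl _ V W); split; first by split.
exists a, f => q [Vq Wq]; have [hf es] := h q Wq; exists hf; rewrite -es.
by congr (sval s q _); exact: Prop_irrelevance.
Qed.

Definition spec_res (s : spec_section U) : spec_section V := exist _ _ (sec_res s).

Let spec_resB : zmod_morphism spec_res.
Proof. by move=> s t; exact: spec_section_eq. Qed.

Let spec_resM : monoid_morphism spec_res.
Proof. by split=> [|s t]; exact: spec_section_eq. Qed.

HB.instance Definition _ := GRing.isZmodMorphism.Build _ _ spec_res spec_resB.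
HB.instance Definition _ := GRing.isMonoidMorphism.Build _ _ spec_res spec_resM.

End Restriction.

Let spec_res_id U (h : U `<=` U) (s : spec_section U) : spec_res h s = s.
Proof.
apply: spec_section_eq => p Up /=.
by congr (sval s p _); exact: Prop_irrelevance.
Qed.

Let spec_res_comp U V W (h : V `<=` U) (k : W `<=` V) (l : W `<=` U)
  (s : spec_section U) : spec_res k (spec_res h s) = spec_res l s.
Proof.
apply: spec_section_eq => p Up /=.
by congr (sval s p _); exact: Prop_irrelevance.
Qed.

Let spec_sheaf : is_sheaf (P := spec_section) spec_res.
Proof.
move=> U I V VU cov s comp.
have cov' p : carrier U p -> {i | carrier (V i) p}.
  by move=> Up; apply: cid; have [i _ Vi] := cov p Up; exists i.
pose t p (Up : carrier U p) : loc p := sval (s _) p (svalP (cov' p Up)).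
have tE p Up i (Vi : carrier (V i) p) : t p Up = sval (s i) p Vi.
  rewrite /t; case: (cov' p Up) => j /= Vj.
  have := congr1 (fun u => sval u p (conj Vj Vi)) (comp j i) => /= e.
  transitivity (sval (s j) p (@capl _ _ _ _ (conj Vj Vi))).
    by congr (sval (s j) p _); exact: Prop_irrelevance.
  by rewrite e; congr (sval (s i) p _); exact: Prop_irrelevance.
have tP : locally_fraction t.
  move=> p Up; have [i _ Vi] := cov p Up.
  have [W [WV [Wp [a [f h]]]]] := svalP (s i) p Vi.
  exists W, (subset_trans WV (VU i)); split=> //; exists a, f => q Wq.
  have [hf es] := h q Wq; exists hf.
  by rewrite -es; exact: tE.
exists (exist _ t tP); split=> [i|u uP].
  by apply: spec_section_eq => p Vp; exact: tE.
apply: spec_section_eq => p Up /=; have [i _ Vi] := cov p Up.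
rewrite (tE _ _ _ Vi) -uP /=.
by congr (sval u p _); exact: Prop_irrelevance.
Qed.

Definition Spec : ringedSpace :=
  @RingedSpace (spec A) (fun U => spec_section U)
    (fun U V h => spec_res h) spec_res_id spec_res_comp spec_sheaf.

End StructureSheaf.

Definition affine_chart (X : ringedSpace) (x : X) (A : comPzRingType)
    (i : ringedHom (Spec A) X) : Prop :=
  open_immersion i /\ range i x.

Record scheme := Scheme {
  scheme_space :> ringedSpace;
  scheme_local : forall x : scheme_space, is_local (stalk x);
  scheme_affine : forall x : scheme_space,
    exists (A : comPzRingType) (i : ringedHom (Spec A) scheme_space),
      affine_chart x i }.

Definition locally_noetherian (X : scheme) : Prop :=
  forall x : X, exists (A : comPzRingType) (i : ringedHom (Spec A) X),
    is_noetherian A /\ affine_chart x i.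

Record schemeHom (X Y : scheme) := SchemeHom {
  scheme_hom :> ringedHom X Y;
  scheme_hom_local : forall x : X, is_local_hom (stalk_map scheme_hom x) }.

Definition local_stalk (X : scheme) (x : X) : localRing :=
  LocalRing (@scheme_local X x).

Section Coherent.
Variables (X : ringedSpace) (F : moduleSheaf X).

(* The morphism O_U^n -> F|_U given by s is surjective. *)
Definition generates (U : opens X) (n : nat) (s : 'I_n -> msec F U) : Prop :=
  forall (V : opens X) (h : V `<=` U) (t : msec F V) (y : X), carrier V y ->
  exists (W : opens X) (k : W `<=` V), carrier W y /\
  exists c : 'I_n -> sec W,
    mres k t = \sum_(i < n) c i *: mres (subset_trans k h) (s i).

Definition finite_type : Prop :=
  forall x : X, exists U : opens X, carrier U x /\
  exists (n : nat) (s : 'I_n -> msec F U), generates s.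

(* a is a section over V of the kernel of O_U^n -> F|_U. *)
Definition is_relation (U V : opens X) (h : V `<=` U) (n : nat)
    (s : 'I_n -> msec F U) (a : 'I_n -> sec V) : Prop :=
  \sum_(i < n) a i *: mres h (s i) = 0.

(* The kernel of O_U^n -> F|_U is of finite type. *)
Definition relations_finite_type (U : opens X) (n : nat) (s : 'I_n -> msec F U) :
    Prop :=
  forall x : X, carrier U x ->
  exists (V : opens X) (h : V `<=` U), carrier V x /\
  exists (m : nat) (r : 'I_m -> 'I_n -> sec V),
    (forall j, is_relation h s (r j)) /\
    forall (W : opens X) (k : W `<=` V) (a : 'I_n -> sec W),
      is_relation (subset_trans k h) s a ->
      forall y : X, carrier W y ->
      exists (W' : opens X) (l : W' `<=` W), carrier W' y /\
      exists c : 'I_m -> sec W',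
        forall i, res l (a i) = \sum_(j < m) c j * res (subset_trans l k) (r j i).

(* The intrinsic definition of EGA 0_I.5.3, valid on any ringed space; on a
   locally noetherian scheme it amounts to quasi-coherent of finite type. *)
Definition coherent : Prop :=
  finite_type /\
  forall (U : opens X) (n : nat) (s : 'I_n -> msec F U), relations_finite_type s.

End Coherent.

Definition flat_over (X S : scheme) (f : schemeHom X S) (F : moduleSheaf X) : Prop :=
  forall x : X, flat (restrict_scalars (stalk_map f x) (mstalk F x)).

(* Flatness over X itself, that is, relative to the identity of X. *)
Definition flat_module (X : scheme) (F : moduleSheaf X) : Prop :=
  forall x : X, flat (mstalk F x).

(* Main.v *)
Require Import Defs.
From mathcomp Require Import all_boot all_order all_algebra.
From mathcomp Require Import boolp classical_sets topology_structure.
From HB Require Import structures.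
From mathcomp Require Import ring.

(* At a point [x] of [X] let [A -> B] be the local homomorphism of stalks and [M]
   the stalk of the module.  Choose minimal generators [x_1, ..., x_p] and
   [y_1, ..., y_n] of the maximal ideals of [A] and [B], so that [n <= p], and
   write [x_i = sum_k a_ik y_k] in [B], [alpha_i = sum_k a_ik e_k] in the
   exterior algebra on [e_1, ..., e_n], with [d e_k = y_k] the Koszul
   differential, so that [d alpha_i = x_i].  Flatness of [M] over [A] gives: if
   [sum_i x_i u_i = 0] in [M] then each [u_i] lies in [m_A M].

   Let [g] be a Koszul 1-cycle with coefficients in [M].  Each product of [g]
   with [p] of the [alpha_i] vanishes, because [p + 1 > n]; removing the [alpha_i]
   one at a time, by applying [d] and the property above, shows that [g] is a
   boundary modulo [m_A].  A relation between minimal generators of [M] yields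
   such a 1-cycle; lifting it to a free cover [B^r -> M] with kernel [L], one gets
   [L = m_B L + (L meet m_A B^r) = m_B L], the last step by flatness over [A].
   Hence [L = 0] by Nakayama, and [M] is free. *)

Set Implicit Arguments.
Unset Strict Implicit.
Unset Printing Implicit Defensive.

Import GRing.Theory.

Local Open Scope classical_set_scope.
Local Open Scope ring_scope.

(** * Generators over local rings *)

Section Span.
Variables (R : comPzRingType) (V : lmodType R).

Definition in_span n (g : 'I_n -> V) (v : V) : Prop :=
  exists c : 'I_n -> R, v = \sum_(i < n) c i *: g i.

Lemma in_spanD n (g : 'I_n -> V) u v :
  in_span g u -> in_span g v -> in_span g (u + v).
Proof.
move=> [c ->] [d ->]; exists (fun i => c i + d i).
by rewrite -big_split; apply: eq_bigr => i _; rewrite scalerDl.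
Qed.

Lemma in_spanZ n (g : 'I_n -> V) a v : in_span g v -> in_span g (a *: v).
Proof.
move=> [c ->]; exists (fun i => a * c i).
by rewrite scaler_sumr; apply: eq_bigr => i _; rewrite scalerA.
Qed.

Lemma in_span0 n (g : 'I_n -> V) : in_span g 0.
Proof. by exists (fun=> 0); rewrite big1 // => i _; rewrite scale0r. Qed.

Lemma in_span_sum n (g : 'I_n -> V) (I : Type) (r : seq I) (F : I -> V) :
  (forall i, in_span g (F i)) -> in_span g (\sum_(i <- r) F i).
Proof.
by move=> h; elim/big_ind: _ => //; [exact: in_span0|move=> *; exact: in_spanD].
Qed.

Lemma in_span_gen n (g : 'I_n -> V) i : in_span g (g i).
Proof.
exists (fun j => (j == i)%:R); rewrite (bigD1 i) //= eqxx scale1r big1 ?addr0 //.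
by move=> j /negPf->; rewrite scale0r.
Qed.

End Span.

Section LocalRing.
Variable R : localRing.

Lemma nonunit0 : @nonunits R 0. Proof. by case: (localP R). Qed.

Lemma nonunitD (a b : R) : nonunits a -> nonunits b -> nonunits (a + b).
Proof. by case: (localP R) => _ + _; exact. Qed.

Lemma nonunitM (a b : R) : nonunits b -> nonunits (a * b).
Proof. by case: (localP R) => _ _; exact. Qed.

Lemma nonunit1 : ~ @nonunits R 1.
Proof. by apply; exists 1; rewrite mulr1. Qed.

Lemma nonunit_sum (I : Type) (r : seq I) (F : I -> R) :
  (forall i, nonunits (F i)) -> nonunits (\sum_(i <- r) F i).
Proof.
move=> h; elim/big_ind: _ => //; first exact: nonunit0.
by move=> *; exact: nonunitD.
Qed.

(** A relation with a unit coefficient solves for one generator, which is then dropped; induction on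
    the number of generators. *)
Lemma minimal_generators (V : lmodType R) n (g : 'I_n -> V) :
  exists (m : nat) (h : 'I_m -> V),
    [/\ forall i, in_span g (h i), forall i, in_span h (g i) &
        forall c : 'I_m -> R, \sum_(i < m) c i *: h i = 0 -> forall i, nonunits (c i)].
Proof.
elim: n => [|n IH] in g *.
  by exists 0, g; split=> [[]|[]|? _ []].
case: (pselect (forall c : 'I_n.+1 -> R, \sum_i c i *: g i = 0 ->
  forall i, nonunits (c i))) => [h|].
  by exists n.+1, g; split=> // i; exact: in_span_gen.
move=> /existsNP[c /not_implyP[c0 /existsNP[i /contrapT[u cu]]]].
have [m [h [hg gh hmin]]] := IH (fun j => g (lift i j)).
have gli j : in_span h (g (lift i j)) by exact: gh.
exists m, h; split=> //.
  move=> j; have [d ->] := hg j; apply: in_span_sum => k; apply: in_spanZ.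
  exact: in_span_gen.
move=> j; case: (unliftP i j) => [k ->|->]; first exact: gli.
move: c0; rewrite (bigD1_ord i) //= => /(congr1 (fun v => u *: v)).
rewrite scaler0 scalerDr scalerA mulrC cu scale1r => /eqP.
rewrite addr_eq0 => /eqP ->; rewrite -scaleN1r; do 2!apply: in_spanZ.
by apply: in_span_sum => k; apply: in_spanZ; exact: gli.
Qed.

(** This plays the part of Nakayama's lemma: moving everything to one side makes [1 - c i] a
    coefficient of a relation, hence a nonunit, and [1] would be a sum of nonunits. *)
Lemma minimal_not_in_mul (V : lmodType R) n (h : 'I_n -> V) (c : 'I_n -> R) i :
  (forall c : 'I_n -> R, \sum_i c i *: h i = 0 -> forall i, nonunits (c i)) ->
  (forall j, nonunits (c j)) -> h i <> \sum_j c j *: h j.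
Proof.
move=> hmin cm e; apply: nonunit1; rewrite -(subrK (c i) 1).
apply: nonunitD => //.
have := hmin (fun j => (j == i)%:R - c j) _ i; rewrite eqxx; apply.
under eq_bigr do rewrite scalerBl.
rewrite sumrB -e (bigD1 i) //= eqxx scale1r big1 ?addr0 ?subrr //.
by move=> j /negPf->; rewrite scale0r.
Qed.

End LocalRing.

Definition is_submodule (R : comPzRingType) (V : lmodType R) (L : set V) : Prop :=
  [/\ L 0, (forall u v, L u -> L v -> L (u + v)) & forall a v, L v -> L (a *: v)].

Lemma submodule_sum (R : comPzRingType) (V : lmodType R) (L : set V)
    (I : Type) (r : seq I) (F : I -> V) :
  is_submodule L -> (forall i, L (F i)) -> L (\sum_(i <- r) F i).
Proof.
by move=> [L0 LD _] h; elim/big_ind: _ => //; exact: LD.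
Qed.

(** Induction on [n]: the coefficients of [g ord0] in elements of [L] form a finitely generated
    ideal. Lifts of its generators, together with generators of the part of [L] spanned by the other
    [g j], generate [L]. *)
Lemma noetherian_submodule (R : comPzRingType) (V : lmodType R) n (g : 'I_n -> V)
    (L : set V) :
  is_noetherian R -> is_submodule L -> (forall v, L v -> in_span g v) ->
  exists (m : nat) (h : 'I_m -> V),
    (forall i, L (h i)) /\ forall v, L v -> in_span h v.
Proof.
move=> nR; elim: n => [|n IH] in g L *; move=> Lsub Lg.
  exists 0, g; split=> [[]//|v Lv]; exact: Lg.
have [L0 LD LZ] := Lsub.
pose g' j := g (lift ord0 j).
(* Coordinates along [g] need not be unique, so a coefficient of [g ord0] is any [a] that leaves a
   remainder in the span of the other generators. *)
pose I : set R := [set a | exists v, L v /\ in_span g' (v - a *: g ord0)].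
have idI : is_ideal I.
  split.
  - by exists 0; split=> //; rewrite scale0r subrr; exact: in_span0.
  - move=> a b [u [Lu gu]] [v [Lv gv]]; exists (u + v); split; first exact: LD.
    by rewrite scalerDl opprD addrACA; exact: in_spanD.
  - move=> a b [v [Lv gv]]; exists (a *: v); split; first exact: LZ.
    by rewrite -scalerA -scalerBr; exact: in_spanZ.
have [p [a Ia]] := nR I idI.
have aI k : I (a k) by rewrite Ia; exact: (in_span_gen (V := R^o) a k).
have [l lP] := choice aI.
have [||m [h [hL hspan]]] := IH g' [set v | L v /\ in_span g' v].
- split.
  + by split=> //; exact: in_span0.
  + by move=> u v [Lu gu] [Lv gv]; split; [exact: LD|exact: in_spanD].
  + by move=> b v [Lv gv]; split; [exact: LZ|exact: in_spanZ].
- by move=> v [].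
pose hl (i : 'I_(m + p)) := match split i with inl j => h j | inr k => l k end.
have hlh j : hl (lshift p j) = h j by rewrite /hl (unsplitK (inl j)).
have hll k : hl (rshift m k) = l k by rewrite /hl (unsplitK (inr k)).
exists (m + p)%N, hl; split=> [i|v Lv].
  by rewrite /hl; case: split => j; [case: (hL j)|case: (lP j)].
have [c vE] := Lg v Lv.
have [d dE] : exists d : 'I_p -> R, c ord0 = \sum_k d k * a k.
  suff : I (c ord0) by rewrite Ia.
  exists v; split=> //; exists (fun j => c (lift ord0 j)).
  by rewrite vE big_ord_recl addrAC subrr add0r.
have lL : L (\sum_k d k *: l k).
  by apply: submodule_sum => // k; apply: LZ; case: (lP k).
have : in_span h (v - \sum_k d k *: l k).
  apply: hspan; split.
    by apply: LD => //; rewrite -scaleN1r; exact: LZ.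
  have -> : v - \sum_k d k *: l k =
      (v - c ord0 *: g ord0) - \sum_k d k *: (l k - a k *: g ord0).
    under [in RHS]eq_bigr do rewrite scalerBr scalerA.
    by rewrite sumrB -scaler_suml -dE opprB addrA subrK.
  apply: in_spanD.
    exists (fun j => c (lift ord0 j)).
    by rewrite vE big_ord_recl addrAC subrr add0r.
  rewrite -scaleN1r; apply: in_spanZ; apply: in_span_sum => k; apply: in_spanZ.
  by case: (lP k).
move=> [e eE]; rewrite -(subrK (\sum_k d k *: l k) v) eE.
apply: in_spanD; apply: in_span_sum => k; apply: in_spanZ.
  by rewrite -hlh; exact: in_span_gen.
by rewrite -hll; exact: in_span_gen.
Qed.

(** * Koszul complexes *)

Section Koszul.
Variables (B : comPzRingType) (y : nat -> B).

(* The exterior algebra on [e_0, ..., e_(n-1)] with coefficients in [M]: for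
   [n'.+1], the pair [(u, v)] stands for [u + e_n' /\ v].  [contract] is the
   Koszul differential, [e_k |-> y k]. *)
Fixpoint koszul (M : lmodType B) n : lmodType B :=
  if n is n'.+1 then (koszul M n' * koszul M n')%type : lmodType B else M.

Section Operators.
Variable M : lmodType B.

Fixpoint contract n : koszul M n -> koszul M n :=
  match n with
  | 0 => fun=> 0
  | n'.+1 => fun w => (contract w.1 + y n' *: w.2, - contract w.2)
  end.

(** Left exterior multiplication by the 1-form with coefficients [a k]; the minus sign comes from
    moving this form past e_n'. *)
Fixpoint wedge (a : nat -> B) n : koszul M n -> koszul M n :=
  match n with
  | 0 => fun=> 0
  | n'.+1 => fun w => (wedge a w.1, a n' *: w.1 - wedge a w.2)
  end.

(** [kconst] and [kcoef] are the inclusion of the degree 0 part and the projection onto it. *)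
Fixpoint kconst n : M -> koszul M n :=
  match n with
  | 0 => id
  | n'.+1 => fun u => (kconst n' u, 0)
  end.

Fixpoint kcoef n : koszul M n -> M :=
  match n with
  | 0 => id
  | n'.+1 => fun w => kcoef w.1
  end.

Fixpoint koszul_all (P : set M) n : set (koszul M n) :=
  match n with
  | 0 => P
  | n'.+1 => fun w => koszul_all P w.1 /\ koszul_all P w.2
  end.

Let contract_linear n : linear (@contract n).
Proof.
elim: n => [|n IH] c u v /=; first by rewrite scaler0 addr0.
congr pair; rewrite IH.
  by rewrite /= scalerDr scalerDr !scalerA mulrC addrACA.
by rewrite opprD -scalerN.
Qed.
HB.instance Definition _ n :=
  GRing.isLinear.Build B (koszul M n) (koszul M n) *:%R _ (@contract_linear n).

Let wedge_linear a n : linear (@wedge a n).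
Proof.
elim: n => [|n IH] c u v /=; first by rewrite scaler0 addr0.
congr pair; rewrite IH //.
by rewrite /= scalerBr scalerDr !scalerA mulrC opprD addrACA.
Qed.
HB.instance Definition _ a n :=
  GRing.isLinear.Build B (koszul M n) (koszul M n) *:%R _ (@wedge_linear a n).

Let kconst_linear n : linear (@kconst n).
Proof.
elim: n => [|n IH] c u v //=; congr pair; first exact: IH.
by rewrite -[RHS]/(c *: (0 : koszul M n) + 0) scaler0 addr0.
Qed.
HB.instance Definition _ n :=
  GRing.isLinear.Build B M (koszul M n) *:%R _ (@kconst_linear n).

Let kcoef_linear n : linear (@kcoef n).
Proof. by elim: n => [|n IH] c u v //=; exact: IH. Qed.
HB.instance Definition _ n :=
  GRing.isLinear.Build B (koszul M n) M *:%R _ (@kcoef_linear n).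

Lemma kcoef_const n u : kcoef (kconst n u) = u.
Proof. by elim: n. Qed.

Lemma contract_const n u : contract (kconst n u) = 0.
Proof.
elim: n => //= n ->; rewrite [contract 0]linear0 oppr0 add0r.
by rewrite -[RHS]/((0 : koszul M n), (0 : koszul M n)); congr pair; exact: scaler0.
Qed.

Lemma contractK n (w : koszul M n) : contract (contract w) = 0.
Proof.
elim: n w => //= n IH [u v] /=.
rewrite -[RHS]/((0 : koszul M n), (0 : koszul M n)); congr pair.
  by rewrite linearD linearZ /= IH add0r scalerN subrr.
by rewrite linearN /= IH oppr0 oppr0.
Qed.

(** Contraction is an antiderivation; the scalar is the contraction of the 1-form itself. *)
Lemma contract_wedge a n (w : koszul M n) :
  contract (wedge a w) = (\sum_(k < n) a k * y k) *: w - wedge a (contract w).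
Proof.
elim: n w => [|n IH].
  by move=> w /=; rewrite big_ord0 scale0r subr0.
move=> [u v]; rewrite big_ord_recr /= !IH; set s := \sum_(k < n) _.
rewrite -[RHS]/((s + a n * y n) *: u - wedge a (contract u + y n *: v),
  (s + a n * y n) *: v - (a n *: (contract u + y n *: v) - wedge a (- contract v))).
congr pair.
  rewrite [wedge a (_ + _)]linearD linearZ /= scalerBr scalerA scalerDl.
  rewrite (mulrC (y n)) opprD.
  by rewrite !addrA; congr (_ - _); rewrite addrAC.
rewrite [contract (_ - _)]linearB [wedge a (- _)]linearN linearZ /= IH -/s.
rewrite scalerDl scalerDr scalerA.
rewrite !opprD !opprK !addrA; congr (_ - _).
by rewrite [RHS]addrAC addrK addrC.
Qed.

Definition wedges (s : seq (nat -> B)) n (w : koszul M n) : koszul M n :=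
  foldr (fun a => @wedge a n) w s.

Lemma wedges_cat s t n (w : koszul M n) : wedges (s ++ t) w = wedges s (wedges t w).
Proof. exact: foldr_cat. Qed.

Lemma wedges0 s n : wedges s (0 : koszul M n) = 0.
Proof. by elim: s => //= a s ->; rewrite linear0. Qed.

Lemma wedges_linear s n c (u v : koszul M n) :
  wedges s (c *: u + v) = c *: wedges s u + wedges s v.
Proof. by elim: s => //= a s ->; rewrite linearP. Qed.

Lemma wedges_fst s n (w : koszul M n.+1) : (wedges s w).1 = wedges s w.1.
Proof. by elim: s => //= a s ->. Qed.

(** The exterior algebra on [n] generators vanishes above degree [n]; as no grading is defined,
    factors are counted instead. *)
Lemma wedges_top s n (w : koszul M n) : (n < size s)%N -> wedges s w = 0.
Proof.
elim: n => [|n IH] in s w *; first by case: s.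
move=> ns; rewrite [LHS]surjective_pairing wedges_fst IH ?(ltnW ns) //.
(* Factors move one at a time from [r], acting on [n.+1] generators, to [t], acting on the second
   component. Each move leaves a cross term in [w.1] with more than [n] factors, which vanishes by
   induction. *)
suff h (t r : seq (nat -> B)) : (n.+1 < size t + size r)%N -> wedges t (wedges r w).2 = 0.
  by rewrite [(wedges s w).2](h [::] s).
elim: r t => [|a r IHr] t /=; first by rewrite addn0 => /ltnW; exact: IH.
rewrite addnS ltnS => tr.
have e : wedges t (wedge a (wedges r w).2) = 0.
  by rewrite -[wedge _ _]/(wedges [:: a] (wedges r w).2) -wedges_cat IHr // size_cat addn1.
rewrite wedges_fst.
have -> : a n *: wedges r w.1 - wedge a (wedges r w).2 =
   a n *: wedges r w.1 + ((-1) *: wedge a (wedges r w).2 + 0).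
  by rewrite scaleN1r addr0.
by rewrite !wedges_linear e -wedges_cat IH ?size_cat // !scaler0 add0r wedges0 addr0.
Qed.

Variables (p : nat) (x : 'I_p -> B).

Definition in_mul (N : lmodType B) (v : N) : Prop :=
  exists u : 'I_p -> N, v = \sum_i x i *: u i.

(** Quasi-regularity in degree one: with I the ideal generated by the [x i], it amounts to
    injectivity of (N/IN)^p -> IN/I^2N. *)
Definition weakly_regular (N : lmodType B) : Prop :=
  forall u : 'I_p -> N, \sum_i x i *: u i = 0 -> forall i, in_mul (u i).

Lemma in_mulD (N : lmodType B) (u v : N) : in_mul u -> in_mul v -> in_mul (u + v).
Proof.
move=> [c ->] [d ->]; exists (fun i => c i + d i).
by rewrite -big_split; apply: eq_bigr => i _; rewrite scalerDr.
Qed.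

Lemma weakly_regular_koszul n : weakly_regular M -> weakly_regular (koszul M n).
Proof.
move=> h; elim: n => [//|n IH] u u0 i.
have fstS (F : 'I_p -> koszul M n.+1) : (\sum_i F i).1 = \sum_i (F i).1.
  by elim/big_rec2: _ => // j a b _ <-.
have sndS (F : 'I_p -> koszul M n.+1) : (\sum_i F i).2 = \sum_i (F i).2.
  by elim/big_rec2: _ => // j a b _ <-.
have [|v vE] := IH (fun j => (u j).1) _ i; first by have := congr1 fst u0; rewrite fstS.
have [|w wE] := IH (fun j => (u j).2) _ i; first by have := congr1 snd u0; rewrite sndS.
exists (fun j => (v j, w j)).
by rewrite [LHS]surjective_pairing [RHS]surjective_pairing fstS sndS vE wE.
Qed.

Variables (n : nat) (a : 'I_p -> nat -> B).
Hypothesis xE : forall i, x i = \sum_(k < n) a i k * y k.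

(** The Leibniz rule is applied factor by factor to a cycle. That only the indices in [s] contribute
    later singles out the coefficient of a new index. *)
Lemma contract_wedges (s : seq 'I_p) (w : koszul M n) : contract w = 0 ->
  exists2 u : 'I_p -> koszul M n, forall i, i \notin s -> u i = 0 &
    contract (wedges (map a s) w) = \sum_i x i *: u i.
Proof.
move=> w0; elim: s => [|j s [u us uE]] /=.
  by exists (fun=> 0) => //; rewrite w0 big1 // => i _; rewrite scaler0.
exists (fun i => (i == j)%:R *: wedges (map a s) w - wedge (a j) (u i)).
  move=> i; rewrite inE negb_or => /andP[/negPf-> /us->].
  by rewrite scale0r linear0 subr0.
rewrite contract_wedge -xE uE linear_sum /=.
under [RHS]eq_bigr do rewrite scalerBr.
rewrite sumrB; congr (_ - _); last by apply: eq_bigr => i _; rewrite linearZ.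
rewrite (bigD1 j) //= eqxx scale1r big1 ?addr0 // => i /negPf->.
by rewrite scale0r scaler0.
Qed.

(* Descending induction on [size s]: contracting an expression of
   [x_i /\ x_s /\ w] isolates the coefficient [x_s /\ w] of [x_i]. *)
Lemma koszul_cycle (w : koszul M n) :
  weakly_regular M -> contract w = 0 ->
  (forall s, (p <= size s)%N -> wedges s w = 0) ->
  exists v, in_mul (w - contract v).
Proof.
move=> hM w0 wtop.
suff h k (s : seq 'I_p) : uniq s -> (p <= size s + k)%N ->
    exists v, in_mul (wedges (map a s) w - contract v).
  by have [//|//|v] := h p [::]; exists v.
elim: k s => [|k IH] s us sp.
  exists 0; rewrite linear0 wtop ?size_map ?subrr; last by rewrite addn0 in sp.
  by exists (fun=> 0); rewrite big1 // => i _; rewrite scaler0.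
case: (leqP p (size s)) => [ps|sltp]; first by apply: IH; rewrite ?(leq_trans ps) ?leq_addr.
have [i si] : exists i : 'I_p, i \notin s.
  apply/existsP; apply: contraLR sltp; rewrite negb_exists => /forallP h.
  rewrite -leqNgt -{1}(size_enum_ord p); apply: uniq_leq_size => [|i _].
    exact: enum_uniq.
  by have := h i; rewrite negbK.
have [|| v [u uE]] := IH (i :: s); [by rewrite /= si|by rewrite addSnnS|].
have [t ts tE] := contract_wedges s w0.
have := congr1 (@contract n) uE.
rewrite linearB /= contractK subr0 contract_wedge -xE tE.
rewrite [wedge _ (\sum_i _)]linear_sum [contract (\sum_i _)]linear_sum /= => e.
(* Contracting the inductive identity gives a relation among the [x j]. Its coefficient at [i] is
   [wedges (map a s) w - contract y (u i)], because [t i = 0] for [i] outside [s]. *)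
exists (u i).
have [|c cE] := weakly_regular_koszul hM (u := fun j =>
    (j == i)%:R *: wedges (map a s) w - wedge (a i) (t j) - contract (u j)) _ i.
  under eq_bigr do rewrite 2!scalerBr.
  rewrite 2!sumrB; apply/eqP; rewrite subr_eq0; apply/eqP.
  transitivity (x i *: wedges (map a s) w - \sum_j wedge (a i) (x j *: t j)).
    congr (_ - _); last by apply: eq_bigr => j _; rewrite linearZ.
    rewrite (bigD1 i) //= eqxx scale1r big1 ?addr0 // => j /negPf->.
    by rewrite scale0r scaler0.
  by rewrite e; apply: eq_bigr => j _; rewrite linearZ.
by exists c; rewrite -cE eqxx scale1r ts // linear0 subr0.
Qed.

End Operators.
End Koszul.

(** * Koszul complexes under a change of coefficients *)

Section KoszulMap.
Variables (B : comPzRingType) (y : nat -> B) (V M : lmodType B).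
Variable pi : {linear V -> M}.

Fixpoint koszul_map n : koszul V n -> koszul M n :=
  match n with
  | 0 => pi
  | n'.+1 => fun w => (koszul_map w.1, koszul_map w.2)
  end.

Let koszul_map_linear n : linear (@koszul_map n).
Proof.
elim: n => [|n IH] c u v /=; first by rewrite linearP.
by congr pair; exact: IH.
Qed.
HB.instance Definition _ n :=
  GRing.isLinear.Build B (koszul V n) (koszul M n) *:%R _ (@koszul_map_linear n).

Lemma koszul_map_contract n (w : koszul V n) :
  koszul_map (contract y w) = contract y (koszul_map w).
Proof.
elim: n w => [|n IH] w /=; first by rewrite linear0.
by congr pair; rewrite ?linearD ?linearZ ?linearN /= IH.
Qed.

Lemma koszul_map_wedge a n (w : koszul V n) :
  koszul_map (wedge a w) = wedge a (koszul_map w).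
Proof.
elim: n w => [|n IH] w /=; first by rewrite linear0.
by congr pair; rewrite ?linearB ?linearZ /= IH.
Qed.

Lemma koszul_map_const n v : koszul_map (kconst n v) = kconst n (pi v).
Proof. by elim: n => //= n ->; rewrite linear0. Qed.

Lemma koszul_map_surj n (w : koszul M n) :
  (forall u, exists v, u = pi v) -> exists v, w = koszul_map v.
Proof.
move=> h; elim: n w => [//|n IH] [u v].
by have [u' ->] := IH u; have [v' ->] := IH v; exists (u', v').
Qed.

Lemma koszul_map_ker n (w : koszul V n) :
  koszul_map w = 0 -> koszul_all [set v | pi v = 0] w.
Proof.
elim: n w => [//|n IH] [u v] /= uv.
by split; apply: IH; [exact: (congr1 fst uv)|exact: (congr1 snd uv)].
Qed.

(** Only the coefficients of the e_k in [w] reach degree 0 after contraction; they are the [l k],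
    and [L 0] covers the indices beyond [n]. *)
Lemma kcoef_contract (L : set V) n (w : koszul V n) : L 0 -> koszul_all L w ->
  exists2 l : nat -> V, forall k, L (l k) &
    kcoef (contract y w) = \sum_(k < n) y k *: l k.
Proof.
move=> L0; have kL k (u : koszul V k) : koszul_all L u -> L (kcoef u).
  by elim: k u => //= k IH [u v] [+ _]; exact: IH.
elim: n w => [|n IH] /= w; first by exists (fun=> 0); rewrite ?big_ord0.
move=> [/IH[l lL lE] w2]; exists (fun k => if k == n then kcoef w.2 else l k).
  by move=> k; case: eqP => // _; exact: kL.
rewrite linearD linearZ /= lE big_ord_recr /= eqxx; congr (_ + _).
by apply: eq_bigr => k _; rewrite ltn_eqF.
Qed.

End KoszulMap.

(* Working modulo [S] avoids forming the quotient group [V / S] as a target. *)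
Lemma tensor_eq_eval (R : comPzRingType) (N M : lmodType R) (V : zmodType)
    (S : set V) (f : N -> M -> V) :
  S 0 -> (forall u v, S u -> S v -> S (u - v)) ->
  (forall n n' m, S (f (n + n') m - f n m - f n' m)) ->
  (forall n m m', S (f n (m + m') - f n m - f n m')) ->
  (forall a n m, S (f (a *: n) m - f n (a *: m))) ->
  forall s t, tensor_eq s t ->
  S (\sum_(p <- s) f p.1 p.2 - \sum_(p <- t) f p.1 p.2).
Proof.
move=> S0 SB fDl fDr fZ s t.
have SN v : S v -> S (- v) by rewrite -sub0r; exact: SB.
have SD u v : S u -> S v -> S (u + v) by move=> Su /SN /(SB _ _ Su); rewrite opprK.
elim=> {s t} [s|s t _ st|s t u _ st _ tu|s s' t t' _ ss _ tt|s t|m|n n' m|n m m'|a n m].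
- by rewrite subrr.
- by rewrite -opprB; exact: SN.
- by have := SD _ _ st tu; rewrite addrA subrK.
- by rewrite !big_cat /= opprD addrACA; exact: SD.
- by rewrite !big_cat /= addrC subrr.
- rewrite big_seq1 big_nil subr0 /=.
  by have := SN _ (fDl 0 0 m); rewrite addr0 subrr sub0r opprK.
- by rewrite !big_cons !big_nil /= !addr0 opprD addrA.
- by rewrite !big_cons !big_nil /= !addr0 opprD addrA.
- by rewrite !big_seq1; exact: fZ.
Qed.

(** * Flat modules over local rings *)

Section MaxIdealModule.
Variable R : localRing.

(** The maximal ideal is made a submodule of [R^o], so that flatness can be tested on its inclusion
    into the ring. *)
Definition nonunit_pred : {pred R^o} := fun a => `[< @nonunits R a >].

Let nonunit_submod : submod_closed nonunit_pred.
Proof.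
split; first by apply/asboolP; exact: nonunit0.
move=> a u v /asboolP hu /asboolP hv; apply/asboolP.
by apply: nonunitD => //; exact: nonunitM.
Qed.
HB.instance Definition _ :=
  GRing.isSubmodClosed.Build R R^o nonunit_pred nonunit_submod.

Definition max_module := {a : R^o | a \in nonunit_pred}.
HB.instance Definition _ := SubType.on max_module.
HB.instance Definition _ := Choice.on max_module.
HB.instance Definition _ := [SubChoice_isSubLmodule of max_module by <:].

Lemma max_moduleP (z : max_module) : nonunits (val z : R).
Proof. by apply/asboolP; exact: (valP z). Qed.

End MaxIdealModule.

Lemma tensor_regular (R : comPzRingType) (N : lmodType R) (I : Type) (s : seq I)
    (a : I -> R^o) (u : I -> N) :
  tensor_eq [seq (a i, u i) | i <- s] [:: (1, \sum_(i <- s) a i *: u i)].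
Proof.
elim: s => [|i s IH] /=.
  rewrite big_nil; apply: tensor_sym; apply: tensor_trans (tensor_0 R^o (0 : N)).
  apply: tensor_sym.
  by have := tensor_Z (0 : R) (1 : R^o) (0 : N); rewrite scale0r scaler0.
rewrite big_cons -[_ :: _]/([:: (a i, u i)] ++ [seq (a j, u j) | j <- s]).
apply: tensor_trans (tensor_sym (tensor_Dr _ _ _)).
rewrite -[X in tensor_eq _ X]/([:: (1 : R^o, a i *: u i)] ++
  [:: (1 : R^o, \sum_(j <- s) a j *: u j)]).
apply: tensor_cat => //.
have e : (a i : R) *: (1 : R^o) = a i := mulr1 (a i : R).
by have := tensor_Z (a i : R) (1 : R^o) (u i); rewrite e.
Qed.

(** In the tensor product of [A] and [N] all scalars move to the right and the tensor becomes zero;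
    flatness lets this descend along the inclusion of the maximal ideal. *)
Lemma flat_relation (A : localRing) (N : lmodType A) p (x : 'I_p -> max_module A)
    (u : 'I_p -> N) : flat N -> \sum_i (val (x i) : A) *: u i = 0 ->
  tensor_eq [seq (x i, u i) | i <- enum 'I_p] [::].
Proof.
move=> flN xu.
apply: (flN _ _ (\val : {linear max_module A -> A^o}) val_inj).
rewrite -map_comp /=.
apply: (tensor_trans (tensor_regular (enum 'I_p) (fun i => val (x i)) u)).
rewrite big_enum /= xu -(scaler0 N 0); apply: (tensor_trans (tensor_sym (tensor_Z _ _ _))).
by rewrite scale0r; exact: tensor_0.
Qed.

Section LocalFlat.
Variables (A B : localRing) (phi : {rmorphism A -> B}) (M : lmodType B).
Variables (p : nat) (x : 'I_p -> A).
Hypothesis x_nonunit : forall i, nonunits (x i).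
Hypothesis x_span : forall a : A, nonunits a ->
  exists c : 'I_p -> A, a = \sum_i c i * x i.
Hypothesis x_min : forall c : 'I_p -> A,
  \sum_i c i * x i = 0 -> forall i, nonunits (c i).
Hypothesis flM : flat (restrict_scalars phi M).

Let x' i := phi (x i).
Let xm i : max_module A := exist _ (x i : A^o) (asboolT (@x_nonunit i)).
Let N := restrict_scalars phi M.

Let relation (u : 'I_p -> M) : \sum_i x' i *: u i = 0 ->
  tensor_eq [seq (xm i, u i : N) | i <- enum 'I_p] [::].
Proof. exact: (@flat_relation A N p xm u flM). Qed.

(** Coordinates along the minimal generators are linear modulo the maximal ideal, so the [i]-th one
    induces a map from the tensor product of the maximal ideal and [M] to M/IM, with I generated by
    the [x' j]. It sends the tensor of [relation], which is zero, to the class of [u i]. *)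
Lemma flat_weakly_regular : weakly_regular x' M.
Proof.
move=> u xu i.
have coefP (n : max_module A) : exists c : 'I_p -> A, (val n : A) = \sum_j c j * x j.
  exact: x_span (@max_moduleP _ n).
have [c cE] := choice coefP.
(* Two choices of coordinates differ by a relation, whose coefficients are nonunits by minimality.
   Hence the evaluation below is bilinear modulo IM although [c] is an arbitrary choice. *)
have small (b : 'I_p -> A) :
    \sum_j b j * x j = 0 -> forall j (m : M), in_mul x' (phi (b j) *: m).
  move=> bx j m; have [d ->] := x_span (x_min bx (i := j)).
  exists (fun k => phi (d k) *: m).
  rewrite rmorph_sum scaler_suml; apply: eq_bigr => k _.
  by rewrite rmorphM mulrC scalerA.
have mul0 : in_mul x' (0 : M).
  by exists (fun=> 0); rewrite big1 // => j _; rewrite scaler0.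
have mulB (v w : M) : in_mul x' v -> in_mul x' w -> in_mul x' (v - w).
  move=> [d ->] [e ->]; exists (fun j => d j - e j).
  by rewrite -sumrB; apply: eq_bigr => j _; rewrite scalerBr.
have ev := @tensor_eq_eval _ (max_module A) N M (@in_mul B p x' M)
  (fun n (m : M) => phi (c n i) *: m) mul0 mulB.
have : in_mul x' (\sum_j phi (c (xm j) i) *: u j).
  have := ev _ _ _ _ _ (relation xu); rewrite big_map big_enum big_nil subr0; apply.
  - move=> a b m; rewrite -2!scalerBl -2!rmorphB.
    apply: (small (fun j => c (a + b) j - c a j - c b j)).
    under eq_bigr do rewrite 2!mulrBl.
    by rewrite 2!sumrB -!cE /= [X in X - _]addrAC subrr add0r subrr.
  - by move=> a m m'; rewrite scalerDr -addrA -opprD subrr.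
  - move=> a b m.
    rewrite -[a *: m]/(phi a *: (m : M)) scalerA -scalerBl -rmorphM -rmorphB.
    apply: (small (fun j => c (a *: b) j - c b j * a)).
    under eq_bigr do rewrite mulrBl mulrAC.
    by rewrite sumrB -mulr_suml -!cE -[val (a *: b)]/(a * val b) mulrC subrr.
move=> h.
(* The chosen coordinates of [x j] need not be Kronecker deltas, but differ from them by a
   relation. *)
suff hd : in_mul x' (\sum_j phi (c (xm j) i) *: u j - \sum_j phi ((j == i)%:R) *: u j).
  have := mulB _ _ h hd; rewrite opprB addrC subrK.
  rewrite (bigD1 i) //= eqxx rmorph1 scale1r big1 ?addr0; first exact.
  by move=> j /negPf->; rewrite rmorph0 scale0r.
rewrite -sumrB; elim/big_ind: _ => //; first by move=> v w; exact: in_mulD.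
move=> j _; rewrite -scalerBl -rmorphB.
apply: (small (fun k => c (xm j) k - (j == k)%:R)).
under eq_bigr do rewrite mulrBl.
rewrite sumrB -cE /= (bigD1 j) //= eqxx mul1r big1 ?addr0 ?subrr //.
by move=> k; rewrite eq_sym => /negPf->; rewrite mul0r.
Qed.

(** Lifts to [V] of an element of [M] differ by the kernel L of [pi], so the product of a nonunit of
    [A] with a lift is well defined modulo IL, with I generated by the [x' i]. Evaluating the
    vanishing tensor of [relation] shows that L meets IV in IL. *)
Lemma flat_kernel (V : lmodType B) (pi : {linear V -> M}) (v : 'I_p -> V) :
  (forall m, exists w, m = pi w) -> pi (\sum_i x' i *: v i) = 0 ->
  exists2 l : 'I_p -> V, forall i, pi (l i) = 0 &
    \sum_i x' i *: v i = \sum_i x' i *: l i.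
Proof.
move=> pi_surj; rewrite linear_sum.
under eq_bigr do rewrite linearZ; move=> /relation rel.
have [lift liftE] := choice pi_surj.
pose S : set V := [set w | exists2 l : 'I_p -> V, forall i, pi (l i) = 0 &
  w = \sum_i x' i *: l i].
have S0 : S 0.
  exists (fun=> 0) => [i|]; first by rewrite linear0.
  by rewrite big1 // => j _; rewrite scaler0.
have SB w w' : S w -> S w' -> S (w - w').
  move=> [l lk ->] [l' lk' ->]; exists (fun i => l i - l' i) => [i|].
    by rewrite linearB /= lk lk' subrr.
  by rewrite -sumrB; apply: eq_bigr => j _; rewrite scalerBr.
have small (a : A) w : nonunits a -> pi w = 0 -> S (phi a *: w).
  move=> /x_span[d ->] pw; exists (fun k => phi (d k) *: w) => [k|].
    by rewrite linearZ /= pw scaler0.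
  rewrite rmorph_sum scaler_suml; apply: eq_bigr => k _.
  by rewrite rmorphM mulrC scalerA.
have ev := @tensor_eq_eval _ (max_module A) N V S
  (fun n (m : M) => phi (val n : A) *: lift m) S0 SB.
have h : S (\sum_i x' i *: lift (pi (v i))).
  have := ev _ _ _ _ _ rel; rewrite big_map big_enum big_nil subr0; apply.
  - move=> a b m; rewrite -2!scalerBl -2!rmorphB.
    by rewrite [X in X - _]addrAC subrr add0r subrr rmorph0 scale0r.
  - move=> a m m'; rewrite -2!scalerBr; apply: small; first exact: max_moduleP.
    by rewrite !linearB /= -!liftE [X in X - _]addrAC subrr add0r subrr.
  - move=> a b m; rewrite -[val (a *: b)]/(a * val b) rmorphM mulrC -scalerA -scalerBr.
    apply: small; first exact: max_moduleP.
    by rewrite linearB linearZ /= -!liftE subrr.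
suff hd : S (\sum_i x' i *: lift (pi (v i)) - \sum_i x' i *: v i).
  by have := SB _ _ h hd; rewrite opprB addrC subrK.
rewrite -sumrB; elim/big_ind: _ => //.
  move=> a b Sa Sb.
  by have := SB _ _ Sa (SB _ _ S0 Sb); rewrite sub0r opprK.
move=> i _; rewrite -scalerBr; apply: small; first exact: x_nonunit.
by rewrite linearB /= -liftE subrr.
Qed.

End LocalFlat.

(** * Flatness of free modules *)

Section FreeFlat.
Variables (R : comPzRingType) (M : lmodType R) (r : nat) (m : 'I_r -> M).
Hypothesis m_span : forall v, in_span m v.
Hypothesis m_free : forall c : 'I_r -> R, \sum_j c j *: m j = 0 -> forall j, c j = 0.

Let tensor_sum (N : lmodType R) (n : N) (c : 'I_r -> R) (s : seq 'I_r) :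
  tensor_eq [:: (n, \sum_(j <- s) c j *: m j)] [seq (c j *: n, m j) | j <- s].
Proof.
elim: s => [|j s IH].
  rewrite big_nil -(scaler0 M 0); apply: tensor_trans (tensor_sym (tensor_Z _ _ _)) _.
  by rewrite scale0r; exact: tensor_0.
rewrite big_cons; apply: tensor_trans (tensor_Dr _ _ _) _.
rewrite /= -[X in tensor_eq X]/([:: (n, c j *: m j)] ++ [:: (n, \sum_(i <- s) c i *: m i)]).
rewrite -[X in tensor_eq _ X]/([:: (c j *: n, m j)] ++ [seq (c i *: n, m i) | i <- s]).
by apply: tensor_cat => //; exact: tensor_sym (tensor_Z _ _ _).
Qed.

Let tensor_add (N : lmodType R) (f g : 'I_r -> N) (s : seq 'I_r) :
  tensor_eq [seq (f j + g j, m j) | j <- s]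
    ([seq (f j, m j) | j <- s] ++ [seq (g j, m j) | j <- s]).
Proof.
elim: s => [|j s IH] /=; first exact: tensor_refl.
apply: (tensor_trans (tensor_cat (tensor_Dl (f j) (g j) (m j)) IH)).
apply: (@tensor_cat _ _ _ [:: (f j, m j)] [:: (f j, m j)]); first exact: tensor_refl.
rewrite /= -cat1s catA -[in X in tensor_eq _ X]cat1s catA.
by apply: tensor_cat; [exact: tensor_catC|exact: tensor_refl].
Qed.

(** Freeness makes the coordinates [c] linear, so every tensor has a normal form whose coefficients
    [coef] are invariants of the tensor. An injective [g] can be cancelled from them. *)
Lemma free_flat : flat M.
Proof.
have [c cE] := choice m_span.
have cD u v j : c (u + v) j = c u j + c v j.
  apply/eqP; rewrite -subr_eq0; apply/eqP.
  apply: (m_free (c := fun j => c (u + v) j - (c u j + c v j))).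
  under eq_bigr do rewrite scalerBl scalerDl.
  by rewrite sumrB big_split /= -!cE subrr.
have cZ a v j : c (a *: v) j = a * c v j.
  apply/eqP; rewrite -subr_eq0; apply/eqP.
  apply: (m_free (c := fun j => c (a *: v) j - a * c v j)).
  under eq_bigr do rewrite scalerBl -scalerA.
  by rewrite sumrB -scaler_sumr -!cE subrr.
pose coef (N : lmodType R) (s : seq (N * M)) j := \sum_(p <- s) c p.2 j *: p.1.
have nf (N : lmodType R) (s : seq (N * M)) :
    tensor_eq s [seq (coef N s j, m j) | j <- enum 'I_r].
  elim: s => [|[n v] s IH].
    have -> : [seq (coef N [::] j, m j) | j <- enum 'I_r] =
              [seq (0 : N, m j) | j <- enum 'I_r].
      by apply: eq_map => j; rewrite /coef big_nil.
    elim: (enum _) => [|j e IH] /=; first exact: tensor_refl.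
    exact: tensor_cat (tensor_sym (tensor_0 N (m j))) IH.
  have -> : [seq (coef N ((n, v) :: s) j, m j) | j <- enum 'I_r] =
            [seq (c v j *: n + coef N s j, m j) | j <- enum 'I_r].
    by apply: eq_map => j; rewrite /coef big_cons.
  apply: tensor_trans (tensor_sym (tensor_add _ _ _)).
  rewrite -cat1s; apply: tensor_cat => //.
  rewrite {1}(cE v) -big_enum; exact: tensor_sum.
move=> N N' g g_inj s t st.
have gE u j : g (coef N u j) = \sum_(p <- u) c p.2 j *: g p.1.
  by rewrite linear_sum; apply: eq_bigr => q _; rewrite linearZ.
have coef_eq j : coef N s j = coef N t j.
  apply: g_inj; apply/eqP; rewrite -subr_eq0; apply/eqP.
  have := @tensor_eq_eval _ N' M N' [set 0] (fun n v => c v j *: n) erefl.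
  move=> /(_ _ _ _ _ _ _ st); rewrite !big_map 2!gE.
  apply=> [u v -> ->|n n' v|n v v'|a n v]; rewrite /set1 /=.
  - by rewrite subrr.
  - by rewrite scalerDr -addrA -opprD subrr.
  - by rewrite cD scalerDl -addrA -opprD subrr.
  - by rewrite cZ scalerA mulrC subrr.
apply: tensor_trans (nf _ s) _; apply: tensor_trans _ (tensor_sym (nf _ t)).
have -> : [seq (coef N s j, m j) | j <- enum 'I_r] = [seq (coef N t j, m j) | j <- enum 'I_r].
  by apply: eq_map => j; rewrite coef_eq.
exact: tensor_refl.
Qed.

End FreeFlat.

(** * Free covers and the flatness criterion *)

Section Combination.
Variables (R : comPzRingType) (M : lmodType R) (r : nat) (m : 'I_r -> M).

Definition combination (v : 'rV[R]_r) : M := \sum_j v 0 j *: m j.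

Let combination_linear : linear combination.
Proof.
move=> a u v; rewrite /combination scaler_sumr -big_split.
by apply: eq_bigr => j _; rewrite !mxE scalerDl scalerA.
Qed.
HB.instance Definition _ :=
  GRing.isLinear.Build R 'rV[R]_r M *:%R combination combination_linear.

End Combination.

(** Given the first two clauses, the third says that the classes of the [x i] in m/m^2 are linearly
    independent. *)
Definition minimal_max_generators (R : localRing) n (x : 'I_n -> R) : Prop :=
  [/\ forall i, nonunits (x i),
      forall a : R, nonunits a -> exists c : 'I_n -> R, a = \sum_i c i * x i &
      forall c : 'I_n -> R, \sum_i c i * x i = 0 -> forall i, nonunits (c i)].

Lemma minimal_max_generatorsP (R : localRing) : is_noetherian R ->
  exists n (x : 'I_n -> R), minimal_max_generators x.
Proof.
move=> nR; have [n [g gE]] := nR _ (localP R).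
have [m [h [hg gh hmin]]] := minimal_generators (V := R^o) g.
exists m, h; split=> [i|a|c /hmin//].
  suff : nonunits (h i : R) by [].
  by rewrite gE; exact: hg.
rewrite gE => -[c ->]; apply: (in_span_sum (V := R^o)) => i.
exact: (in_spanZ (V := R^o)).
Qed.

Section Criterion.
Variables (A B : localRing) (phi : {rmorphism A -> B}) (M : lmodType B).
Hypothesis phi_local : is_local_hom phi.
Variables (p n : nat) (x : 'I_p -> A) (y : 'I_n -> B).
Hypotheses (xmin : minimal_max_generators x) (ymin : minimal_max_generators y).
Hypothesis np : (n <= p)%N.
Hypothesis flM : flat (restrict_scalars phi M).

(** [y] is continued by 0, as the Koszul operators take sequences indexed by [nat]. *)
Let yn (k : nat) : B := oapp y 0 (insub k).

Let yn_span (b : B) : nonunits b ->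
  exists c : nat -> B, b = \sum_(k < n) c k * yn k.
Proof.
case: ymin => _ h _ /h[c ->]; exists (fun k => oapp c 0 (insub k)).
by apply: eq_bigr => k _; rewrite /yn valK.
Qed.

(** The relation [v] is the contraction of a 1-chain [g] whose image over [M] is a cycle, hence by
    [koszul_cycle] a boundary modulo the [phi (x i)]. Lifting to the free cover writes [v] as a sum
    over [x] plus a sum over [y] with kernel coefficients; [flat_kernel] then corrects the first
    sum. *)
Lemma flat_combination_ker r (m : 'I_r -> M) (v : 'rV[B]_r) :
  (forall u, in_span m u) -> (forall j, nonunits (v 0 j)) -> combination m v = 0 ->
  exists2 l : 'I_p + 'I_n -> 'rV[B]_r, forall i, combination m (l i) = 0 &
    v = \sum_i phi (x i) *: l (inl i) + \sum_k y k *: l (inr k).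
Proof.
move=> m_span vm v0; pose pi := combination m : {linear _ -> _}.
have [xn xs xi] := xmin.
have pi_surj u : exists w, u = pi w.
  have [c ->] := m_span u; exists (\row_j c j).
  by apply: eq_bigr => j _; rewrite mxE.
have [a aE] := choice (fun i => yn_span (phi_local (xn i))).
have [c cE] := choice (fun j => yn_span (vm j)).
pose g : koszul 'rV[B]_r n := \sum_j wedge (c j) (kconst n (delta_mx 0 j)).
have dg : contract yn g = kconst n v.
  rewrite linear_sum [v in RHS]row_sum_delta linear_sum; apply: eq_bigr => j _.
  by rewrite /= contract_wedge contract_const linear0 subr0 -cE linearZ.
have [|||w [u wE]] := @koszul_cycle B yn M p (fun i => phi (x i)) n a aE (koszul_map pi g).
- exact: (flat_weakly_regular xn xs xi flM).
- by rewrite -koszul_map_contract dg koszul_map_const [pi v]v0 linear0.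
(* Each summand of [g] already carries one factor, so [p] more make at least [p + 1 > n]; here
   [n <= p] enters. *)
- move=> s ps; rewrite linear_sum.
  elim/big_ind: _ => [|f h f0 h0|j _]; first exact: wedges0.
    by rewrite -[f]scale1r wedges_linear f0 h0 scaler0 addr0.
  rewrite /= koszul_map_wedge -[wedge _ _]/(wedges [:: c j] _) -wedges_cat.
  by rewrite wedges_top // size_cat addn1 ltnS (leq_trans np).
have [w' w'E] := koszul_map_surj w pi_surj.
have [u' u'E] := choice (fun i => koszul_map_surj (u i) pi_surj).
pose z := g - contract yn w' - \sum_i phi (x i) *: u' i.
have /koszul_map_ker zker : koszul_map pi z = 0.
  rewrite !linearB /= koszul_map_contract -w'E wE linear_sum; apply/eqP.
  rewrite subr_eq0; apply/eqP; apply: eq_bigr => i _.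
  by rewrite linearZ /= -u'E.
have [|l lker lE] := kcoef_contract yn _ zker; first exact: (linear0 pi).
pose t i := kcoef (contract yn (u' i)).
(* The degree 0 part of the contraction of [z]: the boundary dies by [contractK], and [g]
   contributes [v]. *)
have vE : v - \sum_i phi (x i) *: t i = \sum_(k < n) yn k *: l k.
  rewrite -lE 2!linearB /= [contract yn (g - _)]linearB /= dg contractK subr0.
  rewrite kcoef_const; congr (_ - _).
  rewrite [contract _ (\sum_i _)]linear_sum [RHS]linear_sum; apply: eq_bigr => i _.
  by rewrite /= !linearZ.
have [|l' l'ker l'E] := flat_kernel xn xs flM (pi := pi) (v := t) pi_surj.
  rewrite -[\sum_i _](subKr v) vE linearB [pi v]v0 sub0r (linear_sum pi) big1 ?oppr0 //.
  by move=> k _; have lk0 : pi (l k) = 0 := lker k; rewrite (linearZ_LR pi) lk0 scaler0.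
exists (fun s : 'I_p + 'I_n => match s with inl i => l' i | inr k => l k end) => [[i|k]|].
- exact: l'ker.
- exact: lker.
- have -> : v = \sum_i phi (x i) *: t i + \sum_(k < n) yn k *: l k.
    by rewrite -vE addrC subrK.
  by congr (_ + _) => //; apply: eq_bigr => k _; rewrite /yn valK.
Qed.

(** By [flat_combination_ker] each minimal generator of the kernel [L] lies in m_B L, against
    minimality. So there is none, [L] is zero and [m] is a basis. *)
Theorem flat_criterion r0 (m0 : 'I_r0 -> M) :
  is_noetherian B -> (forall u, in_span m0 u) -> flat M.
Proof.
move=> nB m0_span; have [r [m [_ m0m m_min]]] := minimal_generators m0.
have m_span u : in_span m u.
  by have [c ->] := m0_span u; apply: in_span_sum => i; exact: in_spanZ.
pose L : set 'rV[B]_r := [set v | combination m v = 0].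
have Lsub : is_submodule L.
  split=> [|u v|a v]; rewrite /L /=; first exact: linear0.
    by move=> u0 v0; rewrite linearD /= u0 v0 addr0.
  by move=> v0; rewrite linearZ /= v0 scaler0.
have [|k [h0 [h0L Lh0]]] := @noetherian_submodule B _ r (fun j => delta_mx 0 j) L nB Lsub.
  by move=> v _; exists (fun j => v 0 j); exact: row_sum_delta.
have [q [h [hh0 h0h h_min]]] := minimal_generators h0.
have hL i : L (h i).
  have [c ->] := hh0 i; apply: submodule_sum => // j.
  by case: Lsub => _ _; apply; exact: h0L.
have Lh v : L v -> in_span h v.
  by move=> /Lh0[c ->]; apply: in_span_sum => j; exact: in_spanZ.
have q0 (i : 'I_q) : False.
  have [j|l lL hE] := flat_combination_ker m_span _ (hL i).
    exact: (m_min (fun j => h i 0 j) (hL i)).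
  have [c cE] := choice (fun s => Lh _ (lL s)).
  (* These are the coefficients of [h i] along the [h j] once the [l s] are expanded; they are
     nonunits because [phi] is local. *)
  pose d j := \sum_s phi (x s) * c (inl s) j + \sum_s y s * c (inr s) j.
  have yn_ s : nonunits (y s) by case: ymin.
  have xn_ s : nonunits (x s) by case: xmin.
  apply: (@minimal_not_in_mul _ _ _ h d i h_min) => [j|].
    apply: nonunitD; apply: nonunit_sum => s; rewrite mulrC; apply: nonunitM => //.
    exact: phi_local.
  rewrite [LHS]hE.
  under [RHS]eq_bigr do rewrite scalerDl 2!scaler_suml.
  rewrite big_split; congr (_ + _); rewrite exchange_big; apply: eq_bigr => s _.
    by rewrite cE scaler_sumr; apply: eq_bigr => j _; rewrite scalerA.
  by rewrite cE scaler_sumr; apply: eq_bigr => j _; rewrite scalerA.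
apply: (free_flat m_span) => c c0 j.
have : L (\row_j c j).
  by rewrite /L /= -[RHS]c0; apply: eq_bigr => i _; rewrite mxE.
move=> /Lh[d dE]; have := congr1 (fun v : 'rV[B]_r => v 0 j) dE.
by rewrite mxE big1 ?mxE // => i; case: (q0 i).
Qed.

End Criterion.

(** * Dimension of the tangent space *)

(** If [m > n], zero columns and rows complete [P] and [Q] to square matrices, and the determinant
    of the product is both 1 and 0. Determinants are used because [residue_field] is typed as a ring
    only. *)
Lemma mulmx_eq1_leq (R : comPzRingType) m n (P : 'M[R]_(m, n)) (Q : 'M[R]_(n, m)) :
  1 <> 0 :> R -> P *m Q = 1%:M -> (m <= n)%N.
Proof.
move=> R10 PQ; rewrite leqNgt; apply/negP => nm.
have [k mE] : exists k, m = (n + k.+1)%N.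
  by exists (m - n).-1; rewrite prednK ?subn_gt0 // subnKC // ltnW.
subst m; apply: R10.
rewrite -(det1 R (n + k.+1)) -PQ.
have -> : P *m Q = row_mx P (0 : 'M_(_, k.+1)) *m col_mx Q 0.
  by rewrite mul_row_col mul0mx addr0.
rewrite det_mulmx (expand_det_col (row_mx P 0) (rshift n ord0)) big1 ?mul0r //.
by move=> i _; rewrite row_mxEr mxE mul0r.
Qed.

Section TangentDim.
Variables (R : localRing) (n : nat) (x : 'I_n -> R).
Hypothesis xmin : minimal_max_generators x.

Local Notation k := (residue_field R).

Lemma residueP (a b : R) : residue a = residue b <-> nonunits (a - b).
Proof. exact: (rclassP (Z := residue_ring R)). Qed.

Lemma residueD (a b : R) : residue (a + b) = residue a + residue b.
Proof. exact: (rclassD (Z := residue_ring R)). Qed.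

Lemma residueM (a b : R) : residue (a * b) = residue a * residue b.
Proof. exact: (rclassM (Z := residue_ring R)). Qed.

Lemma residue0 : residue (0 : R) = 0.
Proof. exact: (rclass0 (residue_ring R)). Qed.

Lemma residue1 : residue (1 : R) = 1.
Proof. exact: (rclass1 (residue_ring R)). Qed.

Lemma residue10 : 1 <> 0 :> k.
Proof. by rewrite -residue1 -residue0 => /residueP; rewrite subr0; exact: nonunit1. Qed.

(** This is the dual basis: coordinates along [x] are well defined in the residue field by
    minimality, and a tangent form is determined by its values on the [x j]. *)
Lemma tangent_basis_generators :
  exists t : 'I_n -> max_ideal R -> k, is_tangent_basis t.
Proof.
have [xn xs xi] := xmin.
have [c cE] := choice (fun z : max_ideal R => xs _ (svalP z)).
have cP (d : 'I_n -> R) (z : max_ideal R) :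
    sval z = \sum_j d j * x j -> forall i, residue (c z i) = residue (d i).
  move=> zE i; apply/residueP; apply: (xi (fun j => c z j - d j)).
  under eq_bigr do rewrite mulrBl.
  by rewrite sumrB -cE -zE subrr.
pose xm j : max_ideal R := exist _ (x j) (@xn j).
have delta i j : residue (c (xm j) i) = (i == j)%:R.
  rewrite (cP (fun i => (i == j)%:R)); first by case: eqP; rewrite ?residue1 ?residue0.
  rewrite /= (bigD1 j) //= eqxx mul1r big1 ?addr0 // => l /negPf->.
  by rewrite mul0r.
exists (fun i z => residue (c z i)); split=> [i a u v w wE|th thT].
  rewrite -residueM -residueD; apply: (cP (fun i => a * c u i + c v i)).
  under eq_bigr do rewrite mulrDl -mulrA.
  by rewrite big_split -mulr_sumr -!cE.
have thE z : th z = \sum_i th (xm i) * residue (c z i).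
  (* Partial sums carry their membership in the maximal ideal, so that additivity of [th] applies by
     induction on the list. *)
  pose zr (s : seq 'I_n) : max_ideal R :=
    exist _ (\sum_(i <- s) c z i * x i)
      (@nonunit_sum _ _ s _ (fun i => @nonunitM R (c z i) (x i) (@xn i))).
  have h s : th (zr s) = \sum_(i <- s) th (xm i) * residue (c z i).
    elim: s => [|i s IH].
      have := thT 1 (zr [::]) (zr [::]) (zr [::]).
      rewrite /= big_nil mulr0 addr0 residue1 mul1r => /(_ erefl) e.
      by rewrite big_nil; apply: (addrI (th (zr [::]))); rewrite addr0.
    rewrite big_cons -IH mulrC; apply: thT.
    by rewrite /= big_cons.
  rewrite -big_enum -h -[th z]add0r -(mul0r (th z)) -residue0.
  symmetry; apply: thT; rewrite mul0r add0r /= big_enum.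
  by rewrite -cE.
exists (fun i => th (xm i)); split; first by apply: funext => z; exact: thE.
move=> d dE; apply: funext => j; rewrite dE (bigD1 j) //= delta eqxx mulr1.
apply: (etrans _ (addr0 (d j))); congr (_ + _); apply: big1 => i /negPf ij.
by rewrite delta ij mulr0.
Qed.

End TangentDim.

(** The transition matrices multiply to the identity by uniqueness of coordinates. *)
Lemma tangent_basis_leq (R : localRing) m n (t : 'I_m -> max_ideal R -> residue_field R)
    (u : 'I_n -> max_ideal R -> residue_field R) :
  is_tangent_basis t -> is_tangent_basis u -> (m <= n)%N.
Proof.
move=> [tT tB] [uT uB].
have tE i : exists c : 'I_n -> residue_field R, t i = fun z => \sum_j c j * u j z.
  by have [c [cE _]] := uB _ (tT i); exists c.
have uE j : exists c : 'I_m -> residue_field R, u j = fun z => \sum_i c i * t i z.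
  by have [c [cE _]] := tB _ (uT j); exists c.
have [P PE] := choice tE; have [Q QE] := choice uE.
apply: (@mulmx_eq1_leq (residue_field R) _ _ (\matrix_(i, j) P i j) (\matrix_(j, i) Q j i)).
  exact: residue10.
have PQ i : (fun l => \sum_j P i j * Q j l) = (fun l => (i == l)%:R).
  have [c [_ cU]] := tB _ (tT i); transitivity c; [symmetry|]; apply: cU.
    apply: funext => z; rewrite {1}PE.
    under eq_bigr do rewrite QE mulr_sumr.
    rewrite exchange_big; apply: eq_bigr => l _; rewrite mulr_suml.
    by apply: eq_bigr => j _; rewrite mulrA.
  apply: funext => z; rewrite (bigD1 i) //= eqxx mul1r.
  apply: (etrans (esym (addr0 (t i z)))); congr (_ + _); symmetry; apply: big1 => l.
  by rewrite eq_sym => /negPf->; rewrite mul0r.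
apply/matrixP => i l; rewrite !mxE.
under eq_bigr do rewrite !mxE.
exact: (congr1 (fun f => f l) (PQ i)).
Qed.

(** [tangent_dim] picks the size of some basis; [x] provides one of size [n], and all bases have the
    same size. *)
Lemma tangent_dimE (R : localRing) n (x : 'I_n -> R) :
  minimal_max_generators x -> tangent_dim R = n.
Proof.
move=> xmin; have [t tB] := tangent_basis_generators xmin.
have [u uB] : exists u, @is_tangent_basis R (tangent_dim R) u.
  by apply: (@xgetPex _ 0%N [set k | exists u, @is_tangent_basis R k u]); exists n, t.
apply/eqP; rewrite eqn_leq.
by rewrite (tangent_basis_leq tB uB) (tangent_basis_leq uB tB).
Qed.

(** * Stalks *)

Lemma ideal_sum (R : comPzRingType) (J : set R) (I : Type) (r : seq I) (F : I -> R) :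
  is_ideal J -> (forall i, J (F i)) -> J (\sum_(i <- r) F i).
Proof. by move=> [J0 JD _] h; elim/big_ind: _ => //; exact: JD. Qed.

(** An ideal [J] of [R] is generated by the images of its preimage in [A]: if [psi a * u] lies in
    [J], multiplying by [psi f] shows that [psi a] does. *)
Lemma noetherian_fractions (A R : comPzRingType) (psi : {rmorphism A -> R}) :
  (forall e : R, exists a f u, psi f * u = 1 /\ e = psi a * u) ->
  is_noetherian A -> is_noetherian R.
Proof.
move=> fracP nA J idJ; have [J0 JD JM] := idJ.
have [|n [g gE]] := nA [set a | J (psi a)].
  split=> /= [|a b|a b]; first by rewrite rmorph0.
    by rewrite rmorphD; exact: JD.
  by rewrite rmorphM; exact: JM.
exists n, (fun k => psi (g k)); apply/seteqP; split=> e /=.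
  move=> Je; have [a [f [u [fu eE]]]] := fracP e.
  have : J (psi a) by rewrite -[psi a]mulr1 -fu mulrA [_ * _ * u]mulrAC -eE mulrC; exact: JM.
  rewrite -[J _]/([set b | J (psi b)] a) gE => -[c aE].
  exists (fun k => psi (c k) * u); rewrite eE aE rmorph_sum mulr_suml.
  by apply: eq_bigr => k _; rewrite rmorphM mulrAC.
move=> [c ->]; apply: ideal_sum => // k; apply: JM.
suff : [set b | J (psi b)] (g k) by [].
by rewrite gE; exact: (in_span_gen (V := A^o)).
Qed.

Lemma noetherian_bij (R S : comPzRingType) (f : {rmorphism R -> S}) :
  injective f -> (forall s, exists r, s = f r) -> is_noetherian S -> is_noetherian R.
Proof.
move=> f_inj f_surj nS J idJ; have [J0 JD JM] := idJ.
have [|n [g gE]] := nS [set s | exists2 r, J r & s = f r].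
  split; first by exists 0; rewrite ?rmorph0.
    by move=> _ _ [a Ja ->] [b Jb ->]; exists (a + b); rewrite ?rmorphD //; exact: JD.
  move=> s _ [b Jb ->]; have [a ->] := f_surj s.
  by exists (a * b); rewrite ?rmorphM //; exact: JM.
have gJ k : exists r, J r /\ g k = f r.
  have : [set s | exists2 r, J r & s = f r] (g k).
    by rewrite gE; exact: (in_span_gen (V := S^o)).
  by move=> [r Jr gr]; exists r.
have [h hP] := choice gJ.
exists n, h; apply/seteqP; split=> a /=.
  move=> Ja; have : [set s | exists2 r, J r & s = f r] (f a) by exists a.
  rewrite gE => -[c cE]; have [d dE] := choice (fun k => f_surj (c k)).
  exists d; apply: f_inj; rewrite cE rmorph_sum; apply: eq_bigr => k _.
  by rewrite rmorphM; case: (hP k) => _ <-; rewrite dE.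
by move=> [c ->]; apply: ideal_sum => // k; apply: JM; case: (hP k).
Qed.

Section GermRing.
Variables (X : ringedSpace) (x : X).
Implicit Types U V W : opens X.

Lemma germ_atW (P : stalk x -> Prop) :
  (forall U (Ux : carrier U x) (s : sec U), P (germ_at Ux s)) -> forall a, P a.
Proof. by move=> h; elim/rclassW=> -[U Ux s]; exact: h. Qed.

Lemma germ_atP U (Ux : carrier U x) (s : sec U) V (Vx : carrier V x) (t : sec V) :
  germ_at Ux s = germ_at Vx t <->
  exists W (h : W `<=` U) (k : W `<=` V), carrier W x /\ res h s = res k t.
Proof. exact: (rclassP (Z := germ_ring x)). Qed.

Lemma germ_at_res U V (h : V `<=` U) (Ux : carrier U x) (Vx : carrier V x) (s : sec U) :
  germ_at Vx (res h s) = germ_at Ux s.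
Proof.
apply/germ_atP; exists V, (@subset_refl _ _), h; split=> //.
by rewrite res_trans; exact: res_irr.
Qed.

Lemma germ_atB U (Ux : carrier U x) : zmod_morphism (germ_at (U := U) Ux).
Proof.
move=> s t; rewrite /germ_at -rclassN -rclassD; apply/rclassP.
have h : U `<=` opens_cap U U by [].
exists U, (@subset_refl _ _), h; split=> //=.
rewrite !rmorphD !rmorphN !res_trans.
by congr (_ - _); exact: res_irr.
Qed.

Lemma germ_atM U (Ux : carrier U x) : monoid_morphism (germ_at (U := U) Ux).
Proof.
split=> [|s t].
  rewrite -rclass1; apply/rclassP; exists U, (@subset_refl _ _), (fun _ _ => I).
  by split=> //=; rewrite !rmorph1.
rewrite /germ_at -rclassM; apply/rclassP.
have h : U `<=` opens_cap U U by [].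
exists U, (@subset_refl _ _), h; split=> //=.
rewrite !rmorphM !res_trans.
by congr (_ * _); exact: res_irr.
Qed.

HB.instance Definition _ U Ux :=
  GRing.isZmodMorphism.Build _ _ (germ_at (U := U) Ux) (germ_atB Ux).
HB.instance Definition _ U Ux :=
  GRing.isMonoidMorphism.Build _ _ (germ_at (U := U) Ux) (germ_atM Ux).

End GermRing.

Lemma stalk_mapE (X Y : ringedSpace) (f : ringedHom X Y) (x : X) (V : opens Y)
    (Vfx : carrier V (f x)) (s : sec V) :
  stalk_map f x (germ_at Vfx s) =
  germ_at (Vfx : carrier (opens_preim (hmap_continuous f) V) x) (comap f V s).
Proof. exact: stalk_funE. Qed.

(** * Noetherian stalks of schemes *)

Section OpenImmersion.
Variables (X Y : ringedSpace) (f : ringedHom X Y).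
Hypothesis f_open : open_immersion f.

Let image (W : opens X) : opens Y :=
  let: And3 _ fo _ := f_open in Opens (fo W (carrier_open W)).

Let imageE (W : opens X) : carrier (image W) = f @` W.
Proof. by rewrite /image; case: f_open. Qed.

Let image_preim (W : opens X) : opens_preim (hmap_continuous f) (image W) `<=` W.
Proof.
case: f_open => f_inj _ _ y; rewrite /= /preimage /= imageE => -[w Ww /f_inj <-].
exact: Ww.
Qed.

Let comap_bij (W : opens X) : bijective (comap f (image W)).
Proof.
case: f_open => _ _; apply; rewrite imageE => _ [w _ <-]; by exists w.
Qed.

(** A germ sent to zero pulls back to zero on some [W]; as [comap] is injective over the open image
    of [W], the section vanishes there already. *)
Lemma open_immersion_stalk_inj x : injective (stalk_map f x).
Proof.
suff h a : stalk_map f x a = 0 -> a = 0 by apply: raddf_inj; exact: h.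
elim/germ_atW: a => U Ux s.
pose fU := opens_preim (hmap_continuous f) U.
have z : 0 = germ_at (Ux : carrier fU x) 0 by rewrite rmorph0.
rewrite stalk_mapE {1}z => e0; have [W [h [h' [Wx]]]] := proj1 (germ_atP _ _ _ _) e0.
rewrite rmorph0 => e.
have hU : image W `<=` U by rewrite imageE => _ [w Ww <-]; exact: (h w Ww).
have Wfx : carrier (image W) (f x) by rewrite imageE; exists x.
have s0 : res hU s = 0.
  apply: (bij_inj (comap_bij W)); rewrite rmorph0 comap_resE.
  by rewrite -(res_comp h (image_preim (W := W))) e rmorph0.
by rewrite -(germ_at_res hU Ux Wfx) s0 rmorph0.
Qed.

(** A section over [W] is restricted to the preimage of the image of [W], where it comes from a
    section on [Y] by bijectivity of [comap]. *)
Lemma open_immersion_stalk_surj x (b : stalk x) : exists a, b = stalk_map f x a.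
Proof.
elim/germ_atW: b => W Wx t.
have [g _ gK] := comap_bij W.
have Wfx : carrier (image W) (f x) by rewrite imageE; exists x.
exists (germ_at Wfx (g (res (image_preim (W := W)) t))).
by rewrite stalk_mapE gK; symmetry; exact: germ_at_res.
Qed.

End OpenImmersion.

Section SpecStalk.
Variable A : comPzRingType.
Implicit Types U V : opens (spec A).

Let notin1 (q : spec A) : ~ prime_set q 1. Proof. by case: (Defs.primeP q). Qed.

Let notinM (q : spec A) a b : ~ prime_set q a -> ~ prime_set q b -> ~ prime_set q (a * b).
Proof. by case: (Defs.primeP q) => _ _ h qa qb /h[]. Qed.

Lemma spec_cstB U : zmod_morphism (spec_cst U : A -> sec (r := Spec A) U).
Proof.
move=> a b; apply: spec_section_eq => q Uq /=.
rewrite fracN (fracD _ _ _ _ _ (notinM (@notin1 q) (@notin1 q))).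
by apply/fracP; exists 1; [exact: notin1|ring].
Qed.

Lemma spec_cstM U : monoid_morphism (spec_cst U : A -> sec (r := Spec A) U).
Proof.
split=> [|a b]; apply: spec_section_eq => q Uq //=.
rewrite (fracM _ _ _ _ _ (notinM (@notin1 q) (@notin1 q))).
by apply/fracP; exists 1; [exact: notin1|ring].
Qed.

HB.instance Definition _ U := GRing.isZmodMorphism.Build A (sec (r := Spec A) U)
  (spec_cst U) (@spec_cstB U).
HB.instance Definition _ U := GRing.isMonoidMorphism.Build A (sec (r := Spec A) U)
  (spec_cst U) (@spec_cstM U).

Definition spec_germ (p : spec A) : A -> stalk (X := Spec A) p :=
  @germ_at (Spec A) p (openT_opens (spec A)) I \o @spec_cst A (openT_opens (spec A)).
HB.instance Definition _ p := GRing.RMorphism.on (spec_germ p).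

(** Near [p] a section is a/f, and 1/f is itself a section on the same open set, inverse to [f].
    This is the input of [noetherian_fractions] and avoids identifying the stalk with a
    localization. *)
Lemma spec_stalk_fraction (p : spec A) (e : stalk (X := Spec A) p) :
  exists a f u, spec_germ p f * u = 1 /\ e = spec_germ p a * u.
Proof.
elim/germ_atW: e => U Up s.
have [V [VU [Vp [a [f h]]]]] := svalP s p Up.
have f_notin q (Vq : carrier V q) : ~ prime_set q f by case: (h q Vq).
have uP : locally_fraction (U := V) (fun q Vq => Defs.frac (Defs.primeP q) 1 (f_notin q Vq)).
  move=> q Vq; exists V, (@subset_refl _ _); split=> //.
  exists 1, f => r Vr; exists (f_notin r Vr).
  by congr (Defs.frac _ _ _); exact: Prop_irrelevance.
pose u : sec (r := Spec A) V := exist _ _ uP.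
have T (b : A) : spec_germ p b = @germ_at (Spec A) p V Vp (spec_cst V b).
  rewrite -[LHS](@germ_at_res (Spec A) p (openT_opens (spec A)) V (fun _ _ => I) I Vp
    (spec_cst _ b)).
  by congr (germ_at _ _); apply: spec_section_eq => q Vq.
exists a, f, (@germ_at (Spec A) p V Vp u); rewrite !T -!rmorphM; split.
  rewrite -[1](rmorph1 (@germ_at (Spec A) p V Vp)); congr (germ_at _ _).
  apply: spec_section_eq => q Vq /=.
  rewrite (fracM _ _ _ _ _ (notinM (@notin1 q) (f_notin q Vq))).
  by apply/fracP; exists 1; [exact: notin1|ring].
rewrite -(@germ_at_res (Spec A) p _ _ VU Up Vp); congr (germ_at _ _).
apply: spec_section_eq => q Vq /=.
rewrite (fracM _ _ _ _ _ (notinM (@notin1 q) (f_notin q Vq))).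
have [hf ->] := h q Vq.
by apply/fracP; exists 1; [exact: notin1|ring].
Qed.

End SpecStalk.

Lemma noetherian_stalk (X : scheme) (x : X) : locally_noetherian X ->
  is_noetherian (stalk x).
Proof.
move=> /(_ x)[A [i [nA [i_open [p _ <-]]]]].
apply: (noetherian_bij (f := stalk_map i p)).
- exact: open_immersion_stalk_inj.
- by move=> b; exact: open_immersion_stalk_surj.
- exact: (noetherian_fractions (psi := spec_germ p) (@spec_stalk_fraction A p)).
Qed.

(** * Stalks of modules of finite type *)

Section GermModule.
Variables (X : ringedSpace) (F : moduleSheaf X) (x : X).
Implicit Types U V W : opens X.

Let mresD U V (h : V `<=` U) (s t : msec F U) : mres h (s + t) = mres h s + mres h t.
Proof. exact: (presD (F := module_presheaf F)). Qed.

Lemma mgerm_at_res U V (h : V `<=` U) (Ux : carrier U x) (Vx : carrier V x) (s : msec F U) :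
  mgerm_at Vx (mres h s) = mgerm_at Ux s.
Proof.
apply/zclassP; exists V, (@subset_refl _ _), h; split=> //=.
by rewrite mres_id.
Qed.

Lemma mgerm_atD U (Ux : carrier U x) (s t : msec F U) :
  mgerm_at Ux (s + t) = mgerm_at Ux s + mgerm_at Ux t.
Proof.
rewrite /mgerm_at -[RHS]zclassD; apply/zclassP.
have h : U `<=` opens_cap U U by [].
exists U, (@subset_refl _ _), h; split=> //=.
by rewrite !mresD !(mres_comp _ _ (@subset_refl _ U)).
Qed.

Lemma mgerm_atZ U (Ux : carrier U x) (a : sec U) (s : msec F U) :
  mgerm_at Ux (a *: s) = germ_at Ux a *: mgerm_at Ux s.
Proof.
rewrite /mgerm_at /germ_at mstalk_scaleE; apply/zclassP.
have h : U `<=` opens_cap U U by [].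
exists U, (@subset_refl _ _), h; split=> //=.
by rewrite !mresZ (res_comp _ _ (@subset_refl _ U)) (mres_comp _ _ (@subset_refl _ U)).
Qed.

Lemma mgerm_at_sum U (Ux : carrier U x) n (c : 'I_n -> sec U) (s : 'I_n -> msec F U) :
  mgerm_at Ux (\sum_i c i *: s i) = \sum_i germ_at Ux (c i) *: mgerm_at Ux (s i).
Proof.
rewrite (big_morph (mgerm_at Ux) (mgerm_atD Ux) (_ : _ = 0)).
  by apply: eq_bigr => i _; rewrite mgerm_atZ.
by apply: (addrI (mgerm_at Ux 0)); rewrite -mgerm_atD !addr0.
Qed.

Lemma finite_type_stalk : finite_type F ->
  exists n (s : 'I_n -> mstalk F x), forall t, in_span s t.
Proof.
move=> /(_ x)[U [Ux [n [s sgen]]]].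
exists n, (fun i => mgerm_at Ux (s i)); elim/zclassW => -[V Vx t].
pose UV := opens_cap U V.
(* [generates] concerns opens inside [U], so the section is first restricted to the intersection
   [UV]. *)
have [W [k [Wx [c cE]]]] := sgen UV (@capl _ _ _) (mres (@capr _ _ _) t) x (conj Ux Vx).
exists (fun i => germ_at Wx (c i)).
have -> : zclass (Germ Vx t : germ_zmod (module_presheaf F) x) = mgerm_at Vx t by [].
rewrite -(mgerm_at_res (@capr _ U V) Vx (conj Ux Vx)) -(mgerm_at_res k _ Wx) cE mgerm_at_sum.
by apply: eq_bigr => i _; rewrite (mgerm_at_res _ Ux).
Qed.

End GermModule.

Theorem corollary1p3 (X S : scheme) (f : schemeHom X S)
    (hX : locally_noetherian X) (hS : locally_noetherian S)
    (hT : forall x : X,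
      (tangent_dim (local_stalk x) <= tangent_dim (local_stalk (f x)))%N)
    (F : moduleSheaf X) (hcoh : coherent F) (hflat : flat_over f F) :
  flat_module F.
Proof.
move=> x; have [ft _] := hcoh.
have nB : is_noetherian (local_stalk x) by exact: noetherian_stalk.
have nA : is_noetherian (local_stalk (f x)) by exact: noetherian_stalk.
have [n [y ymin]] := minimal_max_generatorsP nB.
have [p [z zmin]] := minimal_max_generatorsP nA.
(* Tangent dimensions count minimal generators of the maximal ideals, so the hypothesis at [x]
   becomes [n <= p]. *)
have np : (n <= p)%N by have := hT x; rewrite (tangent_dimE ymin) (tangent_dimE zmin).
have [r [s s_span]] := finite_type_stalk x ft.
exact: (@flat_criterion (local_stalk (f x)) (local_stalk x) (stalk_map f x)
  (mstalk F x) (@scheme_hom_local _ _ f x) p n z y zmin ymin np (hflat x) r s nB s_span).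
Qed.
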